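(* Let $A$ be a locally compact abelian group. The following are equivalent: (a) $A$ has property PL; (b) for some $p\ge 1$, the group $A$ has property $BP_{L^p}$; (b') for every $p\ge 1$, the group $A$ has property $BP_{L^p}$; (c) $A$ is compact.
   Context: A length function on a locally compact group $G$ is a function $L:G\to[0,\infty)$ that is bounded on compact subsets, symmetric ($L(g)=L(g^{-1})$) and subadditive ($L(gh)\le L(g)+L(h)$). It is proper if $\{g: L(g)\le R\}$ is relatively compact for every $R\ge 0$. $G$ has property PL if every length function on $G$ is either bounded or proper (equivalently, every locally bounded isometric action of $G$ on a metric space either has all orbits bounded or is metrically proper). For $p\ge 1$, an $L^p$-space is a space $L^p(X,\mu)$ for some measure space $(X,\mu)$. $G$ has property $BP_{L^p}$ if every continuous affine isometric action of $G$ on an $L^p$-space is either bounded (all orbits are bounded) or proper (for every point $x$, $\|gx-x\|\to\infty$ as $g\to\infty$ in $G$, i.e. $\{g:\|gx-x\|\le R\}$ is relatively compact for every $R$). *)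

(* Defs.v *)
From HB Require Import structures.
From mathcomp Require Import all_boot all_order all_algebra.
From mathcomp Require Import all_classical all_reals all_analysis.
From mathcomp Require Import ess_sup_inf measurable_realfun.

Set Implicit Arguments.
Unset Strict Implicit.
Unset Printing Implicit Defensive.

Import Order.TTheory GRing.Theory Num.Theory.
Import numFieldNormedType.Exports.

Local Open Scope classical_set_scope.
Local Open Scope ring_scope.

(* The library's [LspaceType mu p1], measurable functions modulo a.e. equality
   with finite L^p-norm, comes without algebraic structure: we equip it with
   the usual operations on representatives and with the L^p-norm. *)
Section Lspace_normedModType.
Context d (T : measurableType d) (R : realType).
Variables (mu : {measure set T -> \bar R}) (p : \bar R) (p1 : (1 <= p)%E).

Local Notation Lf := (LfunType mu p1).
Local Notation Lp := (LspaceType mu p1).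
Local Notation Q := (@aeEqMfun _ _ R T (measurableTypeR R) mu).

Lemma ae_eq_Lnorm (f g : T -> R) : measurable_fun setT f ->
  measurable_fun setT g -> f = g %[ae mu] ->
  'N[mu]_p[EFin \o f]%E = 'N[mu]_p[EFin \o g]%E.
Proof.
move=> mf mg fg; rewrite unlock /Lnorm; case: p p1 => [r r1|_|//]; last first.
  case: ifPn => // _; apply: eq_ess_sup.
  by apply: filterS fg => x /= /(_ I) ->.
congr (_ `^ _)%E; apply: ge0_ae_eq_integral => //=.
- apply/measurable_EFinP => /=.
  apply: (@measurableT_comp _ _ _ _ _ _ (@powR R ^~ r)) => //.
  exact: measurableT_comp.
- apply/measurable_EFinP => /=.
  apply: (@measurableT_comp _ _ _ _ _ _ (@powR R ^~ r)) => //.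
  exact: measurableT_comp.
- by apply: filterS fg => x /= /[apply] ->.
Qed.

Lemma Lspace_mem_Lfun (u : Lp) : (u : T -> R) \in Lfun mu p.
Proof.
rewrite inE; apply/andP; split; rewrite inE /=.
  exact: (@measurable_funPT _ _ T (measurableTypeR R) (repr (u : Q))).
exact: (@Lebesgue_finite _ _ _ _ _ _ u).
Qed.

Definition Lspace_repr (u : Lp) : Lf := Lfun_Sub p1 (Lspace_mem_Lfun u).

Lemma Lfun_measurableTypeR (f : Lf) :
  (f : T -> measurableTypeR R) \in @mfun _ _ T (measurableTypeR R).
Proof. by rewrite inE; exact: (measurable_funPT f). Qed.

Let mf (f : Lf) : {mfun T >-> measurableTypeR R} :=
  mfun_Sub (Lfun_measurableTypeR f).

Definition Lspace_pi (f : Lf) : Q := \pi_Q%qT (mf f).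

Lemma Lspace_pi_ae (f : Lf) : (Lspace_pi f : T -> R) = (f : T -> R) %[ae mu].
Proof.
have : (repr (Lspace_pi f) = mf f %[mod Q])%qT.
  by rewrite reprK.
by move/eqmodP/asboolP.
Qed.

Lemma Lspace_pi_finite (f : Lf) : finite_norm mu p (Lspace_pi f : T -> R).
Proof.
rewrite /finite_norm (ae_eq_Lnorm _ _ (Lspace_pi_ae f))//.
- exact: Lfunction_finite.
- exact: (@measurable_funPT _ _ T (measurableTypeR R) (repr (Lspace_pi f))).
Qed.

Definition Lspace_class (f : Lf) : Lp :=
  @LebesgueSpace.Pack d T R mu p p1 (Lspace_pi f)
    (LebesgueSpace.Class (isFinLebesgue.Build d T R mu p p1 _ (Lspace_pi_finite f))).

Lemma Lspace_classK (f : Lf) :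
  (Lspace_repr (Lspace_class f) : T -> R) = (f : T -> R) %[ae mu].
Proof. exact: Lspace_pi_ae. Qed.

Lemma Lspace_eqP (u v : Lp) :
  u = v <-> (u : T -> R) = (v : T -> R) %[ae mu].
Proof.
split=> [->|uv]; first exact: ae_eq_refl.
have : (u : Q) = v :> Q.
  rewrite -[LHS](@reprK _ Q) -[RHS](@reprK _ Q).
  by apply/eqmodP/asboolP.
case: u v {uv} => [u [[ufin]]] [v [[vfin]]] /= uv.
by subst v; rewrite (Prop_irrelevance ufin vfin).
Qed.

Lemma Lspace_classP (f g : Lf) :
  Lspace_class f = Lspace_class g <-> (f : T -> R) = (g : T -> R) %[ae mu].
Proof.
split=> [fg|fg].
  apply: ae_eq_trans (Lspace_classK g).
  by rewrite -fg; exact/ae_eq_sym/Lspace_classK.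
apply/Lspace_eqP; apply: ae_eq_trans (Lspace_classK f) _.
by apply: ae_eq_trans fg _; exact/ae_eq_sym/Lspace_classK.
Qed.

Lemma Lspace_reprK (u : Lp) : Lspace_class (Lspace_repr u) = u.
Proof. exact/Lspace_eqP/Lspace_classK. Qed.

HB.instance Definition _ := gen_eqMixin Lp.
HB.instance Definition _ := gen_choiceMixin Lp.

Definition Lspace_zero : Lp := Lspace_class 0.
Definition Lspace_opp (u : Lp) : Lp := Lspace_class (- Lspace_repr u).
Definition Lspace_add (u v : Lp) : Lp :=
  Lspace_class (Lspace_repr u + Lspace_repr v).
Definition Lspace_scale (a : R) (u : Lp) : Lp :=
  Lspace_class (a *: Lspace_repr u).

Lemma Lspace_addE (f g : Lf) :
  Lspace_add (Lspace_class f) (Lspace_class g) = Lspace_class (f + g).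
Proof.
apply/Lspace_classP.
apply: filterS2 (Lspace_classK f) (Lspace_classK g) => x fx gx _.
by rewrite -[LHS]/(Lspace_repr _ x + Lspace_repr _ x) fx// gx.
Qed.

Lemma Lspace_oppE (f : Lf) : Lspace_opp (Lspace_class f) = Lspace_class (- f).
Proof.
apply/Lspace_classP.
apply: filterS (Lspace_classK f) => x fx _.
by rewrite -[LHS]/(- Lspace_repr _ x) fx.
Qed.

Lemma Lspace_scaleE a (f : Lf) :
  Lspace_scale a (Lspace_class f) = Lspace_class (a *: f).
Proof.
apply/Lspace_classP.
apply: filterS (Lspace_classK f) => x fx _.
by rewrite -[LHS]/(a * Lspace_repr _ x) fx.
Qed.

Lemma Lspace_addA : associative Lspace_add.
Proof.
move=> u v w; rewrite -(Lspace_reprK u) -(Lspace_reprK v) -(Lspace_reprK w).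
by rewrite !Lspace_addE addrA.
Qed.

Lemma Lspace_addC : commutative Lspace_add.
Proof. by move=> u v; rewrite /Lspace_add addrC. Qed.

Lemma Lspace_add0 : left_id Lspace_zero Lspace_add.
Proof.
by move=> u; rewrite -(Lspace_reprK u) Lspace_addE add0r.
Qed.

Lemma Lspace_addN : left_inverse Lspace_zero Lspace_opp Lspace_add.
Proof.
by move=> u; rewrite -(Lspace_reprK u) Lspace_oppE Lspace_addE addNr.
Qed.

HB.instance Definition _ := GRing.isZmodule.Build Lp
  Lspace_addA Lspace_addC Lspace_add0 Lspace_addN.

Lemma Lspace_scaleA a b (u : Lp) :
  Lspace_scale a (Lspace_scale b u) = Lspace_scale (a * b) u.
Proof. by rewrite -(Lspace_reprK u) !Lspace_scaleE scalerA. Qed.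

Lemma Lspace_scale1 : left_id 1 Lspace_scale.
Proof. by move=> u; rewrite -(Lspace_reprK u) Lspace_scaleE scale1r. Qed.

Lemma Lspace_scaleDr : right_distributive Lspace_scale +%R.
Proof.
move=> a u v; rewrite -(Lspace_reprK u) -(Lspace_reprK v) /GRing.add/=.
by rewrite !(Lspace_addE, Lspace_scaleE) scalerDr.
Qed.

Lemma Lspace_scaleDl (u : Lp) : {morph Lspace_scale^~ u : a b / a + b}.
Proof.
move=> a b; rewrite -(Lspace_reprK u) [in RHS]/GRing.add/=.
by rewrite !(Lspace_addE, Lspace_scaleE) scalerDl.
Qed.

HB.instance Definition _ := GRing.Zmodule_isLmodule.Build R Lp
  Lspace_scaleA Lspace_scale1 Lspace_scaleDr Lspace_scaleDl.

Definition Lspace_norm (u : Lp) : R := fine 'N[mu]_p[EFin \o (u : T -> R)]%E.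

Lemma Lspace_normE (f : Lf) :
  Lspace_norm (Lspace_class f) = fine 'N[mu]_p[EFin \o f]%E.
Proof.
congr fine; apply: ae_eq_Lnorm (Lspace_classK f) => //.
Qed.

Lemma Lspace_ler_normD (u v : Lp) :
  Lspace_norm (u + v) <= Lspace_norm u + Lspace_norm v.
Proof.
rewrite -(Lspace_reprK u) -(Lspace_reprK v) [in leLHS]/GRing.add/=.
by rewrite Lspace_addE !Lspace_normE ler_LnormD.
Qed.

Lemma Lspace_normZ a (u : Lp) : Lspace_norm (a *: u) = `|a| * Lspace_norm u.
Proof.
rewrite -(Lspace_reprK u) [in LHS]/GRing.scale/=.
rewrite Lspace_scaleE !Lspace_normE; set f := Lspace_repr u.
have -> : 'N[mu]_p[EFin \o (a *: f)]%E = (`|a|%:E * 'N[mu]_p[EFin \o f])%E.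
  exact: LnormZ.
by rewrite -(finite_norm_fine f).
Qed.

Lemma Lspace_norm0_eq0 (u : Lp) : Lspace_norm u = 0 -> u = 0.
Proof.
rewrite -(Lspace_reprK u) Lspace_normE => /fine_Lnormr_eq0 u0.
exact/Lspace_classP.
Qed.

HB.instance Definition _ := Lmodule_isNormed.Build R Lp
  Lspace_ler_normD Lspace_normZ Lspace_norm0_eq0.

Lemma Lspace_normrE (u : Lp) : `|u| = fine 'N[mu]_p[EFin \o (u : T -> R)]%E.
Proof. by []. Qed.

Lemma Lspace_addP (u v : Lp) :
  ((u + v : Lp) : T -> R) = (fun x => (u : T -> R) x + (v : T -> R) x) %[ae mu].
Proof. exact: Lspace_classK. Qed.

Lemma Lspace_scaleP (a : R) (u : Lp) :
  ((a *: u : Lp) : T -> R) = (fun x => a * (u : T -> R) x) %[ae mu].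
Proof. exact: Lspace_classK. Qed.

End Lspace_normedModType.

(* Groups are abelian and written additively: [topologicalZmodType]. *)
Section group_properties.
Context (R : realType).

Definition length_function (G : topologicalZmodType) (L : G -> R) : Prop :=
  [/\ forall g, 0 <= L g,
      forall K : set G, compact K -> has_ubound (L @` K),
      forall g, L (- g) = L g
    & forall g h, L (g + h) <= L g + L h].

Definition proper_length (G : topologicalZmodType) (L : G -> R) : Prop :=
  forall r : R, 0 <= r -> precompact [set g | L g <= r].

Definition property_PL (G : topologicalZmodType) : Prop :=
  forall L : G -> R, length_function L ->
    has_ubound (range L) \/ proper_length L.

(* Each [act g] is bijective, with inverse [act (- g)]. *)
Definition affine_isometric_action (G : topologicalZmodType)
    (E : normedModType R) (act : G -> E -> E) : Prop :=
  [/\ forall x, act 0 x = x,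
      forall g h x, act (g + h) x = act g (act h x),
      forall g (t : R) x y,
        act g ((1 - t) *: x + t *: y) = (1 - t) *: act g x + t *: act g y
    & forall g x y, `|act g x - act g y| = `|x - y|].

Definition continuous_action (G : topologicalZmodType) (E : normedModType R)
    (act : G -> E -> E) : Prop :=
  continuous (fun gx : G * E => act gx.1 gx.2).

Definition bounded_action (G : topologicalZmodType) (E : normedModType R)
    (act : G -> E -> E) : Prop :=
  forall x, bounded_set (range (act ^~ x)).

Definition proper_action (G : topologicalZmodType) (E : normedModType R)
    (act : G -> E -> E) : Prop :=
  forall x (r : R), precompact [set g | `|act g x - x| <= r].

(* L^p-spaces are real, over an arbitrary (not necessarily sigma-finite)
   measure space, and the exponent is finite. *)
Definition property_BPLp (p : R) (p1 : (1 <= p%:E)%E)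
    (G : topologicalZmodType) : Prop :=
  forall (d : measure_display) (X : measurableType d)
    (mu : {measure set X -> \bar R})
    (act : G -> LspaceType mu p1 -> LspaceType mu p1),
    affine_isometric_action act -> continuous_action act ->
    bounded_action act \/ proper_action act.

End group_properties.

(* Main.v *)
Require Import Defs.
From HB Require Import structures.
From mathcomp Require Import all_boot all_order all_algebra.
From mathcomp Require Import all_classical all_reals all_analysis.
From mathcomp Require Import measurable_realfun.
From mathcomp Require Import ring lra zify.

Import Order.TTheory GRing.Theory Num.Theory.
Import numFieldNormedType.Exports.

Local Open Scope classical_set_scope.
Local Open Scope ring_scope.

(** Everything rests on one implication: a noncompact locally compact abelian
    group A acts on some Lp-space by continuous affine isometries, with orbits
    that are neither bounded nor metrically proper ([BPLp_compact]).  The other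
    implications are soft.  A length function is bounded on a compact group, and
    the displacement of the origin under an affine isometric action is a length
    function, so that PL implies BP_Lp for every p ([PL_BPLp]).

    The action is built from a sequence of homomorphisms chi_j from A to the
    circle R/Z.  Let the j-th circle be the interval [j, j+1) of the real line
    and let g rotate it by chi_j(g); the rotations together preserve Lebesgue
    measure, hence give an isometric linear representation on Lp(R).  Let h be
    the function equal to c_j on the first half of the j-th circle, where
    c_j ^ p = 2 ^ j.  It is not in Lp, but h o g - h is as soon as the energy
    sum_j 2^j dist(chi_j(g), Z) is finite, and then its Lp-norm to the power p
    is comparable to the energy.  Conjugating the representation by the
    translation by h gives the affine action u |-> u o g + (h o g - h).  Using
    the indicator of a half circle makes the construction the same for all p.

    It remains to find chi_j whose energy is finite, is continuous at 0, is
    unbounded on A, and is bounded on a set that is not relatively compact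
    ([noncompact_recurrent_system]).  There are two cases.

    If A is generated by a compact neighbourhood V of 0, then V + V is covered
    by V + F with F finite.  If every c in F had a multiple n c of word length
    less than n, any sum of elements of F could be shortened until it had
    boundedly many terms, and A would be compact ([undistorted_generator]).  So
    some c satisfies |n c| >= n for all n, and a Hahn-Banach argument, which
    needs only that word length is subadditive, yields a homomorphism
    phi : A -> R bounded by word length with phi(c) = 1
    ([dominated_homomorphism]).  Put chi_j = phi / N_j with
    N_j = 2 ^ ((j+1)^2): the N_j divide one another and grow so fast that the
    elements N_k c have energy at most 1.

    If A is not compactly generated, there are x_l outside the open subgroup C_l
    generated by V and the previous x_i.  Since R/Z and the direct sum of
    countably many copies of it are divisible, homomorphisms to them extend from
    subgroups; this gives chi_l trivial on C_l and nontrivial at x_l, such that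
    each element of A is killed by all but finitely many chi_l
    ([triangular_system]).  A subsequence that decreases fast enough does the
    job, because differences of the x_l provide, by the pigeonhole principle,
    elements at which finitely many given chi_j are small
    ([triangular_recurrent_system]).

    The representation is strongly continuous because the rotation by a small
    element moves a set of finite measure only a little
    ([rotation_indic_near]); this passes to integrable functions by density and
    to Lp by the Mazur map ([Lp_rotation_continuous]). *)

(** * Subgroups and extension of homomorphisms *)

Section Subgroups.
Context {M : zmodType}.
Implicit Types (S B : set M) (x y : M).

Definition is_subgroup S := S 0 /\ forall x y, S x -> S y -> S (x - y).

Definition disjoint_from S B := forall x, S x -> ~ B x.

Lemma subgroupN {S x} : is_subgroup S -> S x -> S (- x).
Proof. by move=> [S0 SB] Sx; rewrite -sub0r; exact: SB. Qed.

Lemma subgroupD {S x y} : is_subgroup S -> S x -> S y -> S (x + y).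
Proof.
by move=> gS Sx Sy; rewrite -[y]opprK; apply: gS.2 => //; exact: subgroupN.
Qed.

Lemma subgroupMn {S x} n : is_subgroup S -> S x -> S (x *+ n).
Proof.
move=> gS Sx; elim: n => [|n IH]; first by rewrite mulr0n; exact: gS.1.
by rewrite mulrS; exact: subgroupD.
Qed.

Lemma subgroupMz {S x} (i : int) : is_subgroup S -> S x -> S (x *~ i).
Proof.
move=> gS Sx; case: i => n; first exact: subgroupMn.
by rewrite NegzE mulrNz; apply: subgroupN => //; exact: subgroupMn.
Qed.

Lemma subgroup_adjoin {S} x : is_subgroup S ->
  is_subgroup [set y | exists s (i : int), S s /\ y = s + x *~ i].
Proof.
move=> gS; split; first by exists 0, 0; rewrite mulr0z addr0; split => //; exact: gS.1.
move=> _ _ [s [i [Ss ->]]] [t [j [St ->]]]; exists (s - t), (i - j).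
by split; [exact: gS.2|rewrite mulrzBr opprD addrACA].
Qed.

(** Zorn's lemma.  The condition on the maximal [S] is stated elementwise: [S]
    contains every x that can be adjoined without meeting [B]. *)
Lemma maximal_subgroup_disjoint {S0 B} :
  is_subgroup S0 -> disjoint_from S0 B ->
  exists S, [/\ is_subgroup S, S0 `<=` S, disjoint_from S B &
    forall x, (forall s (i : int), S s -> ~ B (s + x *~ i)) -> S x].
Proof.
move=> gS0 S0B.
pose good S := [/\ is_subgroup S, S0 `<=` S & disjoint_from S B].
have gdS0 : good S0 by split.
(* The empty set is allowed because it is the union of the empty chain. *)
have [F Fgood Ftot|S [Sgood maxS]] := @Zorn_bigcup _ [set S | S = set0 \/ good S].
  have [[X FX [x Xx]]|F0] := pselect (exists2 X, F X & X !=set0); last first.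
    left; rewrite -subset0 => x [X FX Xx]; apply: F0; exists X => //.
    by exists x.
  have goodF Y y : F Y -> Y y -> good Y.
    by move=> FY Yy; have [Y0|//] := Fgood Y FY; rewrite Y0 in Yy.
  right; split.
  - split; first by exists X => //; case: (goodF _ _ FX Xx) => -[].
    move=> y z [Y FY Yy] [Z FZ Zz].
    have [YZ|ZY] := Ftot Y Z FY FZ.
      by exists Z => //; case: (goodF _ _ FZ Zz) => -[_ +] _ _; apply=> //; exact: YZ.
    by exists Y => //; case: (goodF _ _ FY Yy) => -[_ +] _ _; apply=> //; exact: ZY.
  - by move=> y S0y; exists X => //; case: (goodF _ _ FX Xx) => _ + _; exact.
  - by move=> y [Y FY Yy]; case: (goodF _ _ FY Yy) => _ _; exact.
have {}Sgood : good S.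
  case: Sgood => // S_0; exfalso; apply: (maxS S0); last by right.
  rewrite S_0; split; first by move=> x.
  by move/(_ 0 gS0.1).
have [gS S0S SB] := Sgood.
exists S; split => // x xB; apply: contrapT => Sx.
apply: (maxS [set y | exists s (i : int), S s /\ y = s + x *~ i]).
  split; first by move=> y Sy; exists y, 0; rewrite mulr0z addr0.
  by move=> sub; apply: Sx; apply: sub; exists 0, 1; rewrite add0r; split => //; exact: gS.1.
right; split; first exact: subgroup_adjoin.
  by move=> y /S0S Sy; exists y, 0; rewrite mulr0z addr0.
by move=> _ [s [i [Ss ->]]]; exact: xB.
Qed.

End Subgroups.

Lemma pair_mulrn (A M : zmodType) (a : A) (m : M) n :
  (a, m) *+ n = (a *+ n, m *+ n).
Proof. by elim: n => [//|n IH]; rewrite !mulrS IH. Qed.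

Lemma pair_addMz (A M : zmodType) (s : A * M) a m (i : int) :
  s + (a, m) *~ i = (s.1 + a *~ i, s.2 + m *~ i).
Proof.
rewrite (_ : (a, m) *~ i = (a *~ i, m *~ i)); first by case: s.
by case: i => n; [exact: pair_mulrn|rewrite !NegzE !mulrNz -!pmulrn pair_mulrn].
Qed.

(** A homomorphism from a subgroup of [A] to [M] is treated as its graph, a
    subgroup of [A * M].  That the graph be functional, or bounded by a given
    function, means that it avoids a set [B] of bad pairs.  So a homomorphism
    extends to all of [A] as soon as it extends by one element. *)
Lemma total_subgroup_disjoint (A M : zmodType) (S0 B : set (A * M)) :
  is_subgroup S0 -> disjoint_from S0 B ->
  (forall S x, is_subgroup S -> S0 `<=` S -> disjoint_from S B ->
     exists m, forall s (i : int), S s -> ~ B (s.1 + x *~ i, s.2 + m *~ i)) ->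
  exists S, [/\ is_subgroup S, S0 `<=` S, disjoint_from S B &
    forall x, exists m, S (x, m)].
Proof.
move=> gS0 S0B ext.
have [S [gS S0S SB maxS]] := maximal_subgroup_disjoint gS0 S0B.
exists S; split => // x; have [m mP] := ext S x gS S0S SB.
by exists m; apply: maxS => s i Ss; rewrite pair_addMz; exact: mP.
Qed.

(** Used for the integers i such that i x lies in a given subgroup, where the
    generator n+1 is the order of x modulo that subgroup. *)
Lemma ideal_int (P : int -> Prop) : P 0 -> (forall i j, P i -> P j -> P (i - j)) ->
  (forall i, P i -> i = 0) \/
  exists2 n : nat, P n.+1%:Z & forall i, P i -> exists q, i = q * n.+1%:Z.
Proof.
move=> P0 PB.
have PN i : P i -> P (- i) by move=> Pi; rewrite -sub0r; exact: PB.
have [[n Pn]|noP] := pselect (exists n : nat, P n.+1%:Z); last first.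
  left => -[[//|n] Pi|n Pi]; exfalso; apply: noP; exists n => //.
  by rewrite -[n.+1%:Z]opprK -NegzE; exact: PN.
right.
have exP : exists n : nat, `[< P n.+1%:Z >] by exists n; apply/asboolP.
case: (ex_minnP exP) => m /asboolP Pm minm.
exists m => // i Pi; exists (i %/ m.+1%:Z)%Z.
have PM k : P (k%:Z * m.+1%:Z).
  elim: k => [|k IH]; first by rewrite mul0r.
  by rewrite intS mulrDl mul1r -[_ * _]opprK; apply: PB => //; exact: PN.
have PMz (k : int) : P (k * m.+1%:Z).
  case: k => k; first exact: PM.
  by rewrite NegzE mulNr; exact/PN/PM.
have : P (i %% m.+1%:Z)%Z.
  rewrite (_ : (i %% m.+1%:Z)%Z = i - (i %/ m.+1%:Z)%Z * m.+1%:Z); first exact: PB.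
  by rewrite {2}(divz_eq i m.+1%:Z) addrC addKr.
have /andP[] : (0 <= (i %% m.+1%:Z)%Z < m.+1%:Z) by rewrite modz_ge0// ltz_pmod.
case E : (i %% m.+1%:Z)%Z => [[|k]|k]// _ km Pk; last first.
  have /minm : `[< P k.+1%:Z >] by apply/asboolP.
  by rewrite leqNgt -ltnS; move: km; rewrite ltz_nat => ->.
by rewrite {1}(divz_eq i m.+1%:Z) E addr0.
Qed.

(** Divisible groups are injective.  The divisible group is [D / K], given by
    representatives in [M]: this avoids quotients, and serves both for R/Z and
    for a direct sum of copies of it. *)
Lemma divisible_extension (A M : zmodType) (D K : set M) (S0 : set (A * M)) :
  is_subgroup D -> is_subgroup K ->
  (forall f n, D f -> exists2 m, D m & K (m *+ n.+1 - f)) ->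
  is_subgroup S0 -> (forall a f, S0 (a, f) -> D f) ->
  (forall f, S0 (0, f) -> K f) ->
  exists h : A -> M, [/\ forall a, D (h a),
    forall a b, K (h (a + b) - h a - h b) &
    forall a f, S0 (a, f) -> K (h a - f)].
Proof.
move=> gD gK divD gS0 S0D S0K.
(* Bad pairs: values outside [D], and nonzero values at 0. *)
pose B : set (A * M) := [set z | ~ D z.2 \/ (z.1 = 0 /\ ~ K z.2)].
have SBD (S : set (A * M)) s : disjoint_from S B -> S s -> D s.2.
  by move=> SB Ss; apply: contrapT => nD; apply: (SB s Ss); left.
have SBK (S : set (A * M)) s : disjoint_from S B -> S s -> s.1 = 0 -> K s.2.
  by move=> SB Ss s0; apply: contrapT => nK; apply: (SB s Ss); right.
have [|S x gS S0S SB|S [gS S0S SB totS]] := @total_subgroup_disjoint A M S0 B gS0.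
- move=> [a f] Sa [/= nD|/= [a0 nK]]; first by apply: nD; exact: S0D Sa.
  by apply: nK; apply: S0K; rewrite -a0.
- have [||P0|[n [f Sf] nP]] := @ideal_int (fun i => exists f, S (x *~ i, f)).
  + by exists 0; rewrite mulr0z; exact: gS.1.
  + by move=> i j [f Sf] [g Sg]; exists (f - g); rewrite mulrzBr; exact: (gS.2 _ _ Sf Sg).
  + exists 0 => -[s r] i Ss; rewrite mul0rz addr0 => -[/=|/= [sx]].
      by apply; exact: (SBD S _ SB Ss).
    apply; have i0 : i = 0.
      apply: P0; exists (- r).
      have -> : x *~ i = - s by rewrite -[RHS]addr0 -sx addrA addNr add0r.
      exact: (subgroupN gS Ss).
    by apply: (SBK S _ SB Ss); rewrite /= -sx i0 mulr0z addr0.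
  (* n+1 is the order of x modulo the domain of S, and m is f divided by it. *)
  + have [m Dm Km] := divD f n (SBD S _ SB Sf).
    exists m => -[s r] i Ss [/=|/= [sx]]; apply.
      by apply: subgroupD; [|exact: (SBD S _ SB Ss)|exact: subgroupMz].
    have [q qi] : exists q, i = q * n.+1%:Z.
      apply: nP; exists (- r).
      have -> : x *~ i = - s by rewrite -[RHS]addr0 -sx addrA addNr add0r.
      exact: (subgroupN gS Ss).
    have -> : r + m *~ i = (r + f *~ q) + (m *+ n.+1 - f) *~ q.
      by rewrite mulrzBl addrA addrAC addrK qi mulrC mulrzA -pmulrn.
    apply: subgroupD => //; last exact: subgroupMz.
    apply: (SBK S (s + x *~ (n.+1%:Z * q), r + f *~ q) SB); last first.
      by rewrite /= mulrC -qi.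
    have := subgroupD gS Ss (subgroupMz q gS Sf).
    by rewrite -[X in S X]/((s, r) + _) pair_addMz /= mulrzA.
have [h Sh] := choice totS.
exists h; split => [a|a b|a f Sf].
- exact: (SBD S _ SB (Sh a)).
- apply: (SBK S (a + b - a - b, _) SB) => /=; last by rewrite -addrA -opprD subrr.
  exact: (gS.2 _ _ (gS.2 _ _ (Sh (a + b)) (Sh a)) (Sh b)).
- apply: (SBK S (a - a, _) SB) => /=; last by rewrite subrr.
  exact: (gS.2 _ _ (Sh a) (S0S _ Sf)).
Qed.

(** * Compactness and word balls *)

(** Compactness for covers by neighbourhoods that need not be open, obtained from
    the filter of the finite index lists that are large enough. *)
Lemma compact_finite_subcover {T : topologicalType} {I : eqType}
    (K : set T) (U : I -> set T) :
  compact K -> (forall x, K x -> exists i, nbhs x (U i)) ->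
  exists s : seq I, forall x, K x -> exists2 i, i \in s & U i x.
Proof.
move=> /compact_near_coveringP cK KU.
pose F := [set P : set (seq I) | exists s : seq I, forall t : seq I, {subset s <= t} -> P t].
have FF : Filter F.
  split; first by exists [::].
    move=> P Q [s sP] [t tQ]; exists (s ++ t) => r str; split.
      by apply: sP => i si; apply: str; rewrite mem_cat si.
    by apply: tQ => i ti; apply: str; rewrite mem_cat ti orbT.
  by move=> P Q PQ [s sP]; exists s => t /sP; exact: PQ.
have [x Kx|s sU] := cK _ F (fun s x => exists2 i, i \in s & U i x) FF.
  have [i xUi] := KU x Kx.
  exists (U i, [set t : seq I | i \in t]) => /=.
    by split => //; exists [:: i] => t; apply; rewrite inE.
  by move=> [y t] [/= Uy ti]; exists i.
by exists s => x; exact: (sU s).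
Qed.

Lemma compact_sub_nondecreasing {T : topologicalType} (K : set T) (U : nat -> set T) :
  (forall m n, (m <= n)%N -> U m `<=` U n) -> compact K ->
  (forall x, K x -> exists n, nbhs x (U n)) -> exists n, K `<=` U n.
Proof.
move=> Umono cK KU; have [s sU] := compact_finite_subcover K U cK KU.
exists (\max_(i <- s) i)%N => x /sU[i si]; apply: Umono.
by rewrite (big_rem i)//= leq_maxl.
Qed.

Lemma nbhs_translate {A : topologicalZmodType} (c : A) (W : set A) :
  nbhs (0 : A) W -> nbhs c [set z | W (z - c)].
Proof.
move=> nW; have : (fun z : A => z - c) @ c --> c - c.
  apply: (@cvg_comp _ _ _ (fun z => (z, c)) (fun z : A * A => z.1 - z.2) _ (nbhs (c, c))).
    by apply: cvg_pair => /=; [exact: cvg_id|exact: cvg_cst].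
  exact: (@sub_continuous A (c, c)).
by move/(_ W); rewrite subrr; exact.
Qed.

Lemma continuous_mulrn {A : topologicalZmodType} n : continuous (fun x : A => x *+ n).
Proof.
elim: n => [|n IH] x; first exact: cvg_cst.
rewrite (_ : (fun y => y *+ n.+1) = (fun y => y + y *+ n)); last first.
  by apply/funext => y; rewrite mulrS.
rewrite /continuous_at.
apply: (@cvg_comp _ _ _ (fun z => (z, z *+ n)) (fun z : A * A => z.1 + z.2) _ (nbhs (x, x *+ n))).
  by apply: cvg_pair => /=; [exact: cvg_id|exact: IH].
exact: (@add_continuous A (x, x *+ n)).
Qed.

Section WordBalls.
Context {A : topologicalZmodType} (V : set A).

Fixpoint word_ball n : set A :=
  if n is m.+1 then [set z | exists x y, [/\ word_ball m x, V y & z = x + y]]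
  else [set 0].

Lemma word_ball1 v : V v -> word_ball 1 v.
Proof. by move=> Vv; exists 0, v; rewrite add0r. Qed.

Lemma word_ballD m n x y :
  word_ball m x -> word_ball n y -> word_ball (m + n) (x + y).
Proof.
move=> mx; elim: n y => [y /= ->|n IH y /= [y' [v [ny' Vv ->]]]].
  by rewrite addn0 addr0.
by rewrite addnS; exists (x + y'), v; split => //; [exact: IH|rewrite addrA].
Qed.

Lemma word_ballMn n k x : word_ball n x -> word_ball (k * n) (x *+ k).
Proof.
move=> nx; elim: k => [//|k IH].
by rewrite mulSn mulrS; exact: word_ballD.
Qed.

Lemma compact_addset (K L : set A) : compact K -> compact L ->
  compact [set z | exists x y, [/\ K x, L y & z = x + y]].
Proof.
move=> cK cL.
rewrite (_ : [set z | _] = (fun x : A * A => x.1 + x.2) @` (K `*` L)).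
  apply: continuous_compact; last exact: compact_setX.
  by apply: continuous_subspaceT; exact: add_continuous.
rewrite eqEsubset; split=> z /=.
  by move=> [x [y [Kx Ly ->]]]; exists (x, y).
by move=> [[x y] [/= Kx Ly] <-]; exists x, y.
Qed.

Lemma compact_word_ball n : compact V -> compact (word_ball n).
Proof.
move=> cV; elim: n => [|n IH]; first exact: compact_set1.
exact: compact_addset.
Qed.

Hypotheses (V0 : V 0) (VN : forall x, V x -> V (- x)).

Lemma word_ballN n x : word_ball n x -> word_ball n (- x).
Proof.
elim: n x => [x /= ->|n IH x /= [y [v [ny Vv ->]]]]; first by rewrite oppr0.
by exists (- y), (- v); rewrite opprD; split => //; [exact: IH|exact: VN].
Qed.

Lemma le_word_ball m n : (m <= n)%N -> word_ball m `<=` word_ball n.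
Proof.
move=> /subnK <-; elim: (n - m)%N => [//|k IH] x /IH kx.
by rewrite addSn; exists x, 0; rewrite addr0.
Qed.

Lemma word_ball_subgroup : is_subgroup [set x | exists n, word_ball n x].
Proof.
split; first by exists 0.
by move=> x y [m mx] [n ny]; exists (m + n)%N; apply: word_ballD => //; exact: word_ballN.
Qed.

End WordBalls.

Section DistortionCompactness.
Context {A : topologicalZmodType} (V : set A).
Hypothesis V0 : V 0.
Hypotheses (cV : compact V) (nV : nbhs (0 : A) V).
Hypothesis genV : forall x, exists n, word_ball V n x.

Lemma translates_cover : exists F : seq A,
  forall x y, V x -> V y -> exists2 c, c \in F & V (x + y - c).
Proof.
have : compact (word_ball V 2) by exact: compact_word_ball.
move=> /(@compact_finite_subcover A A _ (fun c => [set z | V (z - c)])).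
case=> [c _|F cov]; first by exists c; exact: nbhs_translate.
exists F => x y Vx Vy.
by apply: cov; exists x, y; split => //; exact: word_ball1.
Qed.

(** Let [V + V] be contained in [V + F] with [F] finite.  A word of length k+1 is
    then in [V] plus a sum of at most k elements of [F].  If each c in [F] had a
    multiple n c of word length m < n, a sum containing c at least n times could
    be rewritten with fewer terms: replace n c by an element of [V] plus m - 1
    elements of [F], and absorb the element of [V] at the cost of one more.
    So sums of bounded length would suffice, and [A] would be compact. *)
Lemma undistorted_generator : ~ compact [set: A] ->
  exists c, forall n m, word_ball V m (c *+ n) -> (n <= m)%N.
Proof.
move=> ncA; apply: contrapT => nodist; apply: ncA.
have [F VVF] := translates_cover.
have shortn c : exists nm : nat * nat, (nm.2 < nm.1)%N /\ word_ball V nm.2 (c *+ nm.1).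
  apply: contrapT => noshort; apply: nodist; exists c => n m mc.
  by rewrite leqNgt; apply/negP => mn; apply: noshort; exists (n, m).
have {}[nm nmP] := choice shortn.
pose n c := (nm c).1; pose m c := (nm c).2.
have Vcons v w : V v -> V w -> exists v' c, [/\ V v', c \in F & v + w = v' + c].
  move=> Vv Vw; have [c cF Vc] := VVF _ _ Vv Vw.
  by exists (v + w - c), c; rewrite subrK.
have ballF k a : word_ball V k.+1 a -> exists v s,
    [/\ V v, {subset s <= F}, (size s <= k)%N & a = v + \sum_(c <- s) c].
  elim: k a => [a [x [v [/= -> Vv ->]]]|k IH a [x [w [/IH [v [s [Vv sF sk ->]]] Vw ->]]]].
    by exists v, [::]; rewrite big_nil add0r addr0.
  have [v' [c [Vv' cF vw]]] := Vcons v w Vv Vw.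
  exists v', (c :: s); split => //.
    by move=> d; rewrite inE => /predU1P[->//|]; exact: sF.
  by rewrite big_cons addrAC vw addrA.
(* A longer list of elements of F contains some c at least n c times. *)
pose N := (\sum_(c <- F) n c)%N.
have long s : {subset s <= F} -> (N < size s)%N -> exists2 c, c \in F & (n c <= count_mem c s)%N.
  move=> sF; rewrite ltnNge => /negP Ns; apply: contrapT => nocnt; apply: Ns.
  apply: (@leq_trans (\sum_(c <- F) count_mem c s)).
    elim: s sF {nocnt} => [//|x s IH] sF /=; rewrite big_split /= -add1n.
    apply: leq_add; last by apply: IH => y ys; apply: sF; rewrite inE ys orbT.
    have xF : x \in F by apply: sF; rewrite inE eqxx.
    by rewrite (big_rem x)//= eqxx.
  rewrite /N !big_seq; apply: leq_sum => c cF; rewrite leqNgt; apply/negP => /ltnW cn.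
  by apply: nocnt; exists c.
have reduce k v s : V v -> {subset s <= F} -> (size s <= k)%N ->
    exists v' s', [/\ V v', {subset s' <= F}, (size s' <= N)%N &
      v + \sum_(c <- s) c = v' + \sum_(c <- s') c].
  elim: k v s => [|k IH] v s Vv sF sk.
    by exists v, s; split => //; exact: leq_trans sk _.
  have [sN|Ns] := leqP (size s) N; first by exists v, s.
  have [c cF cn] := long _ sF Ns.
  have [mn mcn] := nmP c; rewrite -/(n c) -/(m c) in mn mcn.
  (* [r] is [s] with n c copies of c removed. *)
  pose r := nseq (count_mem c s - n c) c ++ [seq x <- s | x != c].
  have sr : \sum_(x <- s) x = c *+ n c + \sum_(x <- r) x.
    rewrite (bigID (pred1 c)) /= big_cat /= big_filter addrA; congr (_ + _).
    rewrite (eq_bigr (fun=> c)); last by move=> x /eqP.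
    rewrite big_const_seq big_nseq !iter_addr_0 -mulrnDr.
    by rewrite subnKC.
  have szr : (size r + n c = size s)%N.
    rewrite size_cat size_nseq size_filter addnAC subnK//.
    by rewrite -(count_predC (pred1 c) s); congr addn; exact: eq_count.
  have rF : {subset r <= F}.
    move=> x; rewrite mem_cat => /orP[|].
      by rewrite mem_nseq => /andP[_ /eqP ->].
    by rewrite mem_filter => /andP[_]; exact: sF.
  clearbody r.
  case: (m c) mn mcn => [|m'] mn mcn.
    rewrite sr mcn add0r; apply: IH => //.
    by rewrite -ltnS (leq_trans _ sk)// -szr -addn1 leq_add2l.
  have [w [t [Vw tF tm wt]]] := ballF _ _ mcn.
  have [v' [d [Vv' dF vw]]] := Vcons v w Vv Vw.
  have [|||v'' [s' [V'' s'F s'N e]]] := IH v' (d :: t ++ r).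
  - by [].
  - move=> x; rewrite inE mem_cat => /predU1P[->//|/orP[]]; [exact: tF|exact: rF].
  - rewrite /= size_cat -ltnS (leq_trans _ sk)// -szr addnC -!addnS leq_add2l.
    exact: leq_ltn_trans mn.
  exists v'', s'; split => //; rewrite -e sr wt big_cons big_cat /=.
  by rewrite !addrA vw.
have [k Fk] : exists k, forall c, c \in F -> word_ball V k c.
  elim: (F) => [|c s [k sk]]; first by exists 0%N.
  have [l lc] := genV c; exists (maxn k l) => d; rewrite inE => /predU1P[->|/sk].
    by apply: le_word_ball lc => //; exact: leq_maxr.
  by apply: le_word_ball => //; exact: leq_maxl.
have sumF s : {subset s <= F} -> word_ball V (size s * k) (\sum_(c <- s) c).
  elim: s => [|c s IH] sF; first by rewrite big_nil.
  rewrite big_cons /= mulSn; apply: word_ballD.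
    by apply: Fk; apply: sF; rewrite inE eqxx.
  by apply: IH => x xs; apply: sF; rewrite inE xs orbT.
rewrite (_ : [set: A] = word_ball V (1 + N * k)); first exact: compact_word_ball.
rewrite eqEsubset; split => // a _.
have [l la] := genV a.
have [v [s [Vv sF sl ->]]] := ballF l a (le_word_ball V V0 _ _ (leqnSn l) _ la).
have [v' [s' [Vv' s'F s'N ->]]] := reduce _ _ _ Vv sF sl.
apply: word_ballD; first exact: word_ball1.
by apply: (le_word_ball V V0 _ _ _ _ (sumF _ s'F)) => //; rewrite leq_mul2r s'N orbT.
Qed.

End DistortionCompactness.

(** * A real homomorphism dominated by word length *)

Lemma exists_separation {R : realType} (L U : set R) :
  L !=set0 -> U !=set0 -> (forall l u, L l -> U u -> l <= u) ->
  exists t, (forall l, L l -> l <= t) /\ (forall u, U u -> t <= u).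
Proof.
move=> L0 [u0 Uu0] LU; exists (sup L); split => [l Ll|u Uu].
  by apply: ub_le_sup => //; exists u0 => l' Ll'; exact: LU.
by apply: ge_sup => // l Ll; exact: LU.
Qed.

(** Hahn-Banach.  When the graph [S] of a partial homomorphism is extended to x,
    each (s, r) in [S] constrains the value t at x: r + i t is at most the word
    length of s + i x, and r - i t that of s - i x.  A lower and an upper
    constraint are compatible because combining them eliminates x and leaves the
    bound already known on [S]; this uses subadditivity of the word length but
    no homogeneity. *)
Lemma dominated_homomorphism {R : realType} {A : topologicalZmodType} (V : set A)
    (c : A) :
  (forall x, exists n, word_ball V n x) ->
  (forall n m, word_ball V m (c *+ n) -> (n <= m)%N) ->
  exists phi : A -> R, [/\ forall a b, phi (a + b) = phi a + phi b,
    forall n, phi (c *+ n) = n%:R &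
    forall n a, word_ball V n a -> phi a <= n%:R].
Proof.
move=> genV cV.
(* Bad pairs: values larger than the word length. *)
pose B : set (A * R) := [set z | exists2 n, word_ball V n z.1 & n%:R < z.2].
pose S0 : set (A * R) := [set z | exists i : int, z = (c *~ i, i%:~R)].
have gS0 : is_subgroup S0.
  split; first by exists 0.
  by move=> _ _ [i ->] [j ->]; exists (i - j); rewrite mulrzBr rmorphB.
have [|S x gS S0S SB|S [gS S0S SB totS]] := @total_subgroup_disjoint A R S0 B gS0.
- move=> _ [i ->] [n /=]; case: i => i.
    by move=> /cV ni; rewrite ltr_nat ltnNge ni.
  by move=> _; rewrite ltNge; move/negP; apply; rewrite (le_trans _ (ler0n _ n))// ler0z.
- have dom s n : S s -> word_ball V n s.1 -> s.2 <= n%:R.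
    by move=> Ss sn; rewrite leNgt; apply/negP => ns; apply: (SB s Ss); exists n.
  pose L : set R := [set t | exists s n i, [/\ S s, word_ball V n (s.1 - x *+ i.+1)
     & t = (s.2 - n%:R) / i.+1%:R]].
  pose U : set R := [set t | exists s n i, [/\ S s, word_ball V n (s.1 + x *+ i.+1)
     & t = (n%:R - s.2) / i.+1%:R]].
  have [|||t [Lt tU]] := @exists_separation R L U.
  + have [n xn] := genV (0 - x *+ 1); exists ((0 - n%:R) / 1%:R).
    by exists 0, n, 0%N; split => //; exact: gS.1.
  + have [n xn] := genV (0 + x *+ 1); exists ((n%:R - 0) / 1%:R).
    by exists 0, n, 0%N; split => //; exact: gS.1.
  + move=> _ _ [s [n [i [Ss ns ->]]]] [s' [n' [i' [Ss' ns' ->]]]].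
    rewrite ler_pdivrMr// mulrAC ler_pdivlMr//.
    have mem : S (s.1 *+ i'.+1 + s'.1 *+ i.+1, s.2 *+ i'.+1 + s'.2 *+ i.+1).
      have := subgroupD gS (subgroupMn i'.+1 gS Ss) (subgroupMn i.+1 gS Ss').
      by case: (s) (s') => [a r] [a' r']; rewrite !pair_mulrn.
    have := dom _ (i'.+1 * n + i.+1 * n')%N mem.
    rewrite /= (_ : s.1 *+ i'.+1 + s'.1 *+ i.+1 =
        (s.1 - x *+ i.+1) *+ i'.+1 + (s'.1 + x *+ i'.+1) *+ i.+1); last first.
      by rewrite mulrnBl mulrnDl -!mulrnA [(i'.+1 * _)%N]mulnC addrACA addNr addr0.
    move=> /(_ (word_ballD _ _ _ _ _ (word_ballMn _ _ _ _ ns) (word_ballMn _ _ _ _ ns'))).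
    rewrite natrD !natrM -[s.2 *+ _]mulr_natr -[s'.2 *+ _]mulr_natr.
    by move=> h; lra.
  + exists t => s [[|i]|i] Ss [n /=].
    * by rewrite !mulr0z !addr0 => /(dom _ _ Ss); rewrite leNgt => /negP.
    * move=> sn; apply/negP; rewrite -leNgt.
      have := tU ((n%:R - s.2) / i.+1%:R).
      rewrite ler_pdivlMr// lerBrDl -pmulrn mulr_natr; apply.
      by exists s, n, i.
    * rewrite NegzE !mulrNz => sn; apply/negP; rewrite -leNgt.
      have := Lt ((s.2 - n%:R) / i.+1%:R).
      rewrite ler_pdivrMr// lerBlDr -lerBlDl -pmulrn mulr_natr; apply.
      by exists s, n, i.
have [phi Sphi] := choice totS.
have uniq a t : S (a, t) -> phi a = t.
  move=> Sat; apply/eqP; rewrite -subr_eq0.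
  have S0t u : S (0, u) -> u <= 0.
    move=> S0u; rewrite leNgt; apply/negP => u0.
    by apply: (SB _ S0u); exists 0%N.
  have Sd : S (0, phi a - t) by rewrite -(subrr a); exact: (gS.2 _ _ (Sphi a) Sat).
  rewrite eq_le S0t//= -oppr_le0; apply: S0t.
  by rewrite -oppr0; exact: (subgroupN gS Sd).
exists phi; split => [a b|n|n a na].
- exact/uniq/(subgroupD gS (Sphi a) (Sphi b)).
- by apply: uniq; apply: S0S; exists n%:Z; rewrite -pmulrn.
- by rewrite leNgt; apply/negP => nphi; apply: (SB _ (Sphi a)); exists n.
Qed.

(** * Homomorphisms to the circle and their energy *)

Section DistanceToIntegers.
Context {R : realType}.
Implicit Types t m : R.

(** The distance to 0 in the circle R/Z. *)
Definition dist_int t : R := `|t - (Num.floor (t + 2^-1))%:~R|.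

Lemma dist_int_ge0 t : 0 <= dist_int t. Proof. exact: normr_ge0. Qed.

Lemma dist_int_half t : dist_int t <= 2^-1.
Proof.
rewrite /dist_int; have := floor_itv (t + 2^-1).
set f := (Num.floor _)%:~R; move=> /andP[]; rewrite rmorphD/= -/f => h1 h2.
by rewrite ler_norml; apply/andP; split; lra.
Qed.

Lemma dist_int_le {t m} : m \is a Num.int -> dist_int t <= `|t - m|.
Proof.
move=> /intrP[i ->]; have := dist_int_half t; rewrite /dist_int.
set k := Num.floor _ => tk.
have [->//|ik] := eqVneq i k.
have ge1 : 1 <= `|(i - k)%:~R : R|.
  by rewrite norm_intr_ge1 ?intr_int// intr_eq0 subr_eq0.
have := ler_distD t i%:~R k%:~R; rewrite -rmorphB/= (distrC i%:~R) => h.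
lra.
Qed.

Lemma dist_int_eq0 t : t \is a Num.int -> dist_int t = 0.
Proof.
move=> /(@dist_int_le t) h; apply/eqP; rewrite eq_le dist_int_ge0 andbT.
by rewrite (le_trans h)// subrr normr0.
Qed.

Lemma dist_int_congr {t m} : t - m \is a Num.int -> dist_int t = dist_int m.
Proof.
have H u v : u - v \is a Num.int -> dist_int u <= dist_int v.
  move=> uv; have := @dist_int_le u (u - v + (Num.floor (v + 2^-1))%:~R).
  rewrite rpredD ?intr_int// => /(_ isT) /le_trans; apply.
  rewrite /dist_int; set k := (Num.floor (v + _))%:~R.
  by rewrite (_ : u - (u - v + k) = v - k)//; ring.
by move=> tm; apply/eqP; rewrite eq_le !H//; rewrite -opprB rpredN.
Qed.

Lemma dist_intN t : dist_int (- t) = dist_int t.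
Proof.
have H u : dist_int (- u) <= dist_int u.
  have := @dist_int_le (- u) (- (Num.floor (u + 2^-1))%:~R).
  by rewrite rpredN intr_int => /(_ isT); rewrite opprK addrC distrC.
by apply/eqP; rewrite eq_le H/= -{1}(opprK t) H.
Qed.

Lemma dist_int_norm t : dist_int t <= `|t|.
Proof. by have := @dist_int_le t 0 (rpred0 _); rewrite subr0. Qed.

Lemma dist_int_small t : `|t| <= 2^-1 -> dist_int t = `|t|.
Proof.
move=> t2; apply/eqP; rewrite eq_le dist_int_norm/=.
rewrite /dist_int; set k := Num.floor _.
have [->|k0] := eqVneq k 0; first by rewrite subr0.
have : 1 <= `|k%:~R : R|.
  by rewrite norm_intr_ge1 ?intr_int// intr_eq0.
have := ler_distD t k%:~R 0; rewrite !subr0 distrC => h1 h2; lra.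
Qed.

(** The first multiple at distance at least 1/4 from 0 has not yet passed 1/2. *)
Lemma dist_int_quarter t : t \isn't a Num.int ->
  exists n, 4^-1 <= dist_int (n%:R * t).
Proof.
move=> tint; pose d := dist_int t.
have [s ts sd] : exists2 s, t - s \is a Num.int & d = `|s|.
  exists (t - (Num.floor (t + 2^-1))%:~R) => //.
  by rewrite opprB addrC subrK intr_int.
have d0 : 0 < d.
  rewrite sd normr_gt0; apply: contraNneq tint => s0.
  by rewrite -[t](subrK s) s0 addr0 -s0.
have multE n : dist_int (n%:R * t) = dist_int (n%:R * d).
  transitivity (dist_int (n%:R * s)).
    by apply: dist_int_congr; rewrite -mulrBr rpredM// natr_int.
  by rewrite sd; case: (ler0P s) => // _; rewrite mulrN dist_intN.
have [d4|d4] := leP 4^-1 d; first by exists 1%N; rewrite mul1r.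
have exn : exists n, 4^-1 <= n%:R * d.
  exists (Num.bound (4^-1 / d)); rewrite -ler_pdivrMr//.
  by apply/ltW; apply: archi_boundP; rewrite divr_ge0// ltW.
case: (ex_minnP exn) => -[|n]; first by rewrite mul0r => h; exfalso; move: h; lra.
move=> hn minn; exists n.+1; rewrite multE.
have nd : n%:R * d < 4^-1 by rewrite ltNge; apply/negP => /minn; rewrite ltnn.
have nd0 : 0 <= n.+1%:R * d by rewrite mulr_ge0// ltW.
rewrite dist_int_small ger0_norm//.
rewrite -natr1 mulrDl mul1r; lra.
Qed.

End DistanceToIntegers.

(** Up to a constant this is the p-th power of the Lp-norm of the displacement of
    the origin under the action built below. *)
Definition energy {R : realType} {A : zmodType} (chi : nat -> A -> R) (g : A) : \bar R :=
  (\sum_(0 <= j <oo) ((2 ^+ j * dist_int (chi j g))%:E))%E.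

(** Homomorphisms to the circle R/Z, given by real representatives. *)
Definition torus_hom {R : realType} {A : zmodType} (chi : A -> R) :=
  forall g h, chi (g + h) - chi g - chi h \is a Num.int.

Lemma torus_homB {R : realType} {A : zmodType} {chi : A -> R} a b :
  torus_hom chi -> chi (a - b) - (chi a - chi b) \is a Num.int.
Proof.
move=> /(_ (a - b) b); rewrite subrK => h.
rewrite (_ : _ - _ = - (chi a - chi (a - b) - chi b)) ?rpredN//; ring.
Qed.

Lemma torus_hom0 {R : realType} {A : zmodType} {chi : A -> R} :
  torus_hom chi -> chi 0 \is a Num.int.
Proof. by move=> /(torus_homB 0 0); rewrite !subrr subr0. Qed.

Lemma torus_homMn {R : realType} {A : zmodType} {chi : A -> R} a n :
  torus_hom chi -> chi (a *+ n) - n%:R * chi a \is a Num.int.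
Proof.
move=> hchi; elim: n => [|n IH].
  by rewrite mulr0n mul0r subr0; exact: torus_hom0.
rewrite mulrS (_ : _ - _ = (chi (a + a *+ n) - chi a - chi (a *+ n)) +
  (chi (a *+ n) - n%:R * chi a)); first exact: rpredD.
by rewrite -natr1; ring.
Qed.

Lemma energy_le {R : realType} {A : zmodType} (chi : nat -> A -> R) g (r : nat -> R) C :
  (forall j, 2 ^+ j * dist_int (chi j g) <= r j) ->
  (forall n, \sum_(0 <= j < n) r j <= C) -> (energy chi g <= C%:E)%E.
Proof.
move=> cr rC; apply: lime_le.
  by apply: is_cvg_ereal_nneg_natsum => j _; rewrite lee_fin mulr_ge0 ?dist_int_ge0// exprn_ge0.
near=> n; rewrite sumEFin lee_fin (le_trans _ (rC n))//.
by apply: ler_sum => j _; exact: cr.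
Unshelve. all: by end_near. Qed.

Lemma sum_half_powers {R : realType} n : \sum_(0 <= j < n) 2^-1 ^+ j.+1 <= 1 :> R.
Proof.
suff -> : \sum_(0 <= j < n) 2^-1 ^+ j.+1 = 1 - 2^-1 ^+ n :> R.
  by rewrite gerBl exprn_ge0.
elim: n => [|n IH]; first by rewrite big_nil expr0 subrr.
by rewrite big_nat_recr//= IH exprS; lra.
Qed.

Lemma energy_le_partial {R : realType} {A : zmodType} (chi : nat -> A -> R) g N :
  (forall j, (N <= j)%N -> chi j g \is a Num.int) ->
  (energy chi g <= (\sum_(0 <= j < N) 2 ^+ j * dist_int (chi j g))%:E)%E.
Proof.
move=> chiN; apply: (@energy_le _ _ _ _ (fun j => 2 ^+ j * dist_int (chi j g))) => [//|n].
have ge0 j : 0 <= 2 ^+ j * dist_int (chi j g) by rewrite mulr_ge0 ?exprn_ge0// dist_int_ge0.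
have [nN|/ltnW Nn] := leqP n N.
  by rewrite (big_cat_nat _ nN)//= lerDl sumr_ge0.
rewrite (big_cat_nat _ Nn)//= gerDl big_nat_cond big1// => j.
by rewrite andbT => /andP[Nj _]; rewrite dist_int_eq0 ?mulr0// chiN.
Qed.

(** Among more than (M+1)^n points of an n-dimensional torus, two lie in the same
    box of side 1/(M+1). *)
Lemma dist_int_pigeonhole {R : realType} n (theta : 'I_n -> nat -> R) (M : nat) :
  exists i l, (i < l)%N /\ forall r, dist_int (theta r l - theta r i) <= M.+1%:R^-1.
Proof.
pose fr (t : R) := t - (Num.floor t)%:~R.
have fr01 t : 0 <= fr t < 1.
  have := floor_itv t; rewrite rmorphD/= /fr => /andP[h1 h2].
  by apply/andP; split; lra.
pose bin i : {ffun 'I_n -> 'I_M.+1} :=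
  [ffun r => inord (Num.truncn (M.+1%:R * fr (theta r i)))].
have close i l : bin i = bin l -> forall r, dist_int (theta r l - theta r i) <= M.+1%:R^-1.
  move=> /ffunP il r; have := il r; rewrite !ffunE => /(congr1 val).
  have M0 : 0 < M.+1%:R :> R by rewrite ltr0n.
  have T t : (Num.truncn (M.+1%:R * fr t) < M.+1)%N.
    have /andP[f0 f1] := fr01 t.
    rewrite -(ltr_nat R).
    have /truncn_itv/andP[+ _] : 0 <= M.+1%:R * fr t by rewrite mulr_ge0// ltW.
    by move=> /le_lt_trans; apply; rewrite -[ltRHS]mulr1 ltr_pM2l.
  rewrite /= !inordK// => ttE.
  have /andP[i0 _] := fr01 (theta r i); have /andP[l0 _] := fr01 (theta r l).
  have /truncn_itv/andP[] : 0 <= M.+1%:R * fr (theta r i) by rewrite mulr_ge0// ltW.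
  have /truncn_itv/andP[] : 0 <= M.+1%:R * fr (theta r l) by rewrite mulr_ge0// ltW.
  rewrite ttE -[(Num.truncn _).+1%:R]natr1 => h1 h2 h3 h4.
  have := @dist_int_le R (theta r l - theta r i)
    ((Num.floor (theta r l))%:~R - (Num.floor (theta r i))%:~R).
  rewrite rpredB ?intr_int// => /(_ isT) /le_trans; apply.
  rewrite (_ : _ - _ = fr (theta r l) - fr (theta r i)); last by rewrite /fr; ring.
  rewrite -[leRHS]mulr1 ler_pdivlMl// -{1}(gtr0_norm M0) -normrM mulrBr.
  by rewrite ler_norml; apply/andP; split; lra.
have [i [l [il bil]]] : exists i l : 'I_(M.+1 ^ n).+1, i != l /\ bin i = bin l.
  apply: contrapT => inj.
  have /leq_card : injective (fun i : 'I_(M.+1 ^ n).+1 => bin i).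
    move=> i l bil; apply/eqP; apply: contrapT => /negP il.
    by apply: inj; exists i, l.
  by rewrite card_ord card_ffun !card_ord ltnn.
have [lt|gt|eq] := ltngtP i l.
- by exists i, l; split => //; exact: close.
- by exists l, i; split => //; apply: close.
- by move: il; rewrite (val_inj eq) eqxx.
Qed.

(** * Recurrent systems on compactly generated groups *)

(** What the affine action needs: finite energy to be defined, small energy near 0
    to be continuous, values far from 0 to have unbounded orbits (as the weights
    2 ^ j are unbounded), and bounded energy on a set that is not relatively
    compact in order not to be proper. *)
Definition recurrent_system {R : realType} {A : topologicalZmodType}
    (chi : nat -> A -> R) :=
  [/\ forall j, torus_hom (chi j),
     forall g, (energy chi g < +oo)%E,
     forall e : R, 0 < e -> \forall g \near (0 : A), (energy chi g <= e%:E)%E,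
     forall j, exists g, 4^-1 <= dist_int (chi j g) &
     exists C : R, ~ precompact [set g | (energy chi g <= C%:E)%E]].

(** The exponents of the periods [N j] below grow so fast that, for k < j, the
    quotient N_j / N_k is at least 2 ^ j times 2 ^ (j+1): the first factor absorbs
    the weight in the energy and the second makes the series converge. *)
Lemma exp_sqr_factor (k j : nat) : (k < j)%N -> exists q,
  (j.+1 ^ 2 = k.+1 ^ 2 + (j + j.+1) + q)%N.
Proof.
move=> kj; exists (j ^ 2 - k.+1 ^ 2)%N.
rewrite -mulnn -(mulnn j) -(mulnn k.+1).
have : (k.+1 * k.+1 <= j * j)%N by apply: leq_mul.
by move=> h; rewrite addnAC subnKC// mulSn mulnS; lia.
Qed.

(** The elements N_k c have energy at most 1: [phi] takes an integral multiple of
    N_j at them when j <= k, and a negligible fraction of N_j when j > k.  They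
    leave every word ball, hence every compact set. *)
Lemma real_recurrent_system {R : realType} {A : topologicalZmodType} (V : set A)
    (phi : A -> R) (c : A) :
  V 0 -> (forall x, V x -> V (- x)) -> nbhs (0 : A) V ->
  (forall x, exists n, word_ball V n x) ->
  (forall a b, phi (a + b) = phi a + phi b) ->
  (forall n, phi (c *+ n) = n%:R) ->
  (forall n a, word_ball V n a -> phi a <= n%:R) ->
  exists chi : nat -> A -> R, recurrent_system chi.
Proof.
move=> V0 VN nV genV phiD phic phi_le.
pose N j : R := 2 ^+ (j.+1 ^ 2).
have N0 j : 0 < N j by rewrite exprn_gt0.
have phi_sub0 : phi 0 = 0.
  by apply: (addrI (phi 0)); rewrite addr0 -phiD addr0.
have phiN a : phi (- a) = - phi a.
  by apply/eqP; rewrite -addr_eq0 -phiD addNr phi_sub0.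
have phi_norm n a : word_ball V n a -> `|phi a| <= n%:R.
  move=> na; rewrite ler_norml phi_le// andbT lerNl -phiN phi_le//.
  exact: word_ballN.
have phiMn n a : phi (a *+ n) = phi a *+ n.
  by elim: n => [|n IH]; rewrite ?mulr0n// !mulrS phiD IH.
pose chi (j : nat) (a : A) : R := phi a / N j.
have bound g : (energy chi g <= `|phi g|%:E)%E.
  apply: (@energy_le _ _ _ _ (fun j => `|phi g| * 2^-1 ^+ j.+1)) => [j|n].
    apply: (@le_trans _ _ (2 ^+ j * `|phi g / N j|)).
      by rewrite ler_pM2l ?dist_int_norm// exprn_gt0.
    rewrite normrM normfV (gtr0_norm (N0 j)) mulrCA ler_wpM2l//.
    rewrite ler_pdivrMr//.
    have -> : N j = 2 ^+ j * (2 ^+ j.+1 * 2 ^+ (j.+1 ^ 2 - (j + j.+1))).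
      rewrite -!exprD; congr (2 ^+ _); rewrite addnA subnKC//.
      by rewrite -mulnn; lia.
    rewrite mulrCA ler_peMr ?exprn_ge0// mulrA -exprMn mulVf// expr1n mul1r.
    by rewrite exprn_ege1// ler1n.
  by rewrite -mulr_sumr ler_piMr// sum_half_powers.
exists chi; rewrite /chi; split.
- by move=> j g h; rewrite phiD mulrDl -addrA -opprD subrr rpred0.
- by move=> g; exact: le_lt_trans (bound g) (ltry _).
- move=> e e0.
  (* If k g is in V then k |phi g| <= 1, hence |phi g| <= e. *)
  pose k := (Num.bound e^-1).+1.
  have ke : k%:R^-1 <= e.
    rewrite -[e]invrK lef_pV2 ?posrE ?invr_gt0// /k -natr1.
    rewrite ler_wpDr// ltW//; apply: archi_boundP.
    by rewrite invr_ge0 ltW.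
  have := @continuous_mulrn A k 0; rewrite /continuous_at mul0rn => /(_ V nV) nVk.
  apply: (@filterS _ (nbhs (0 : A)) _ (fun x => V (x *+ k)) _ _ nVk) => g Vg; apply: (le_trans (bound g)); rewrite lee_fin.
  apply: (le_trans _ ke); rewrite -[leRHS]mulr1 ler_pdivlMl//.
  have := phi_norm 1%N _ (word_ball1 _ _ Vg).
  by rewrite phiMn normrMn -[_ *+ k]mulr_natl.
(* Half a period, where chi j takes the value 1/2. *)
- move=> j; exists (c *+ (2 ^ (j.+1 ^ 2).-1)).
  rewrite phic natrX /N -[in X in _ / X](prednK (_ : 0 < j.+1 ^ 2)%N) ?expn_gt0//.
  rewrite exprS invfM mulrCA mulfV ?mulr1 ?expf_neq0//.
  rewrite dist_int_small ger0_norm//; lra.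
- exists 1 => -[K /= Ksub [cK _]].
  have [n Kn] : exists n, K `<=` word_ball V n.
    apply: compact_sub_nondecreasing => //; first exact: le_word_ball.
    move=> x Kx; have [n nx] := genV x; exists n.+1.
    apply: filterS (nbhs_translate x V nV) => y /= Vyx.
    by exists x, (y - x); rewrite subrKC.
  pose g := c *+ (2 ^ (n.+1 ^ 2)).
  have : word_ball V n g.
    apply: Kn; apply: Ksub => /=.
    apply: (@energy_le _ _ _ _ (fun j => 2^-1 ^+ j.+1)); last exact: sum_half_powers.
    move=> j; rewrite /g phic natrX.
    have [jn|nj] := leqP j n.
      rewrite dist_int_eq0 ?mulr0 ?exprn_ge0//.
      have : (j.+1 ^ 2 <= n.+1 ^ 2)%N by rewrite leq_exp2r.
      move=> /subnK <-; rewrite exprD mulfK ?gt_eqF//.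
      by rewrite -natrX natr_int.
    have [q jE] := exp_sqr_factor _ _ nj.
    apply: (@le_trans _ _ (2 ^+ j * `|2 ^+ (n.+1 ^ 2) / N j|)).
      by rewrite ler_pM2l ?dist_int_norm// exprn_gt0.
    rewrite ger0_norm; last by rewrite divr_ge0 ?exprn_ge0// ltW.
    rewrite mulrA ler_pdivrMr// /N jE !exprD.
    have -> : 2^-1 ^+ j.+1 * (2 ^+ (n.+1 ^ 2) * (2 ^+ j * 2 ^+ j.+1) * 2 ^+ q) =
        2 ^+ j * 2 ^+ (n.+1 ^ 2) * 2 ^+ q :> R.
      rewrite exprVn [LHS](_ : _ = 2 ^+ j * 2 ^+ (n.+1 ^ 2) * 2 ^+ q * (2 ^- j.+1 * 2 ^+ j.+1)).
        by rewrite mulVf ?mulr1// expf_neq0.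
      by ring.
    by rewrite ler_peMr ?mulr_ge0 ?exprn_ge0// exprn_ege1// ler1n.
  move=> /phi_le; rewrite phic ler_nat leqNgt => /negP; apply.
  apply: (@leq_trans (2 ^ n.+1)); first exact: ltnW (ltn_expl _ _).
  by rewrite leq_exp2l// -mulnn leq_pmulr.
Qed.

(** * Extending homomorphisms to the circle *)

Definition generated {M : zmodType} (V : set M) : set M :=
  [set x | forall S, is_subgroup S -> V `<=` S -> S x].

Lemma generated_subgroup {M : zmodType} (V : set M) : is_subgroup (generated V).
Proof.
split=> [S gS _|x y Vx Vy S gS VS]; first exact: gS.1.
by apply: gS.2; [exact: Vx|exact: Vy].
Qed.

Lemma sub_generated {M : zmodType} (V : set M) : V `<=` generated V.
Proof. by move=> x Vx S _; exact. Qed.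

Lemma generatedS {M : zmodType} (V W : set M) : V `<=` W -> generated V `<=` generated W.
Proof. by move=> VW x Vx S gS WS; apply: Vx => // y /VW /WS. Qed.

Definition integers {R : realType} : set R := [set t : R | t \is a Num.int].

Lemma integers_subgroup {R : realType} : is_subgroup (@integers R).
Proof. by split=> [|x y xi yi]; [exact: rpred0|exact: rpredB]. Qed.

(** If n is the order of [x] modulo [C], send [x] to 1/n; if [x] has infinite
    order, any value outside Z would do and 1/2 is taken. *)
Lemma separating_torus_hom {R : realType} {A : zmodType} (C : set A) (x : A) :
  is_subgroup C -> ~ C x ->
  exists chi : A -> R, [/\ torus_hom chi, forall c, C c -> chi c \is a Num.int &
    chi x \isn't a Num.int].
Proof.
move=> gC Cx.
have [t tC tint] : exists2 t : R, forall i : int, C (x *~ i) -> t *~ i \is a Num.int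
    & t \isn't a Num.int.
  have half n : (1 < n)%N -> (n%:R^-1 : R) \isn't a Num.int.
    move=> n1; have n0 : 0 < n%:R :> R by rewrite ltr0n (ltn_trans _ n1).
    apply/negP => /norm_intr_ge1; rewrite invr_eq0 gt_eqF// => /(_ isT).
    by rewrite gtr0_norm ?invr_gt0// leNgt invf_lt1// ltr1n n1.
  have [||P0|[n Cn nP]] := @ideal_int (fun i => C (x *~ i)).
  - by rewrite mulr0z; exact: gC.1.
  - by move=> i j Ci Cj; rewrite mulrzBr; exact: gC.2.
  - exists 2^-1; last exact: half.
    by move=> i /P0 ->; rewrite mulr0z rpred0.
  - exists n.+1%:R^-1; last first.
      by apply: half; case: n Cn {nP} => // /(_ : C (x *~ 1)).
    move=> i /nP[q ->]; rewrite mulrC mulrzA -pmulrn -[_^-1 *+ _]mulr_natr mulVf//.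
(* The multivalued homomorphism c + i x |-> i t + Z on the group generated by C and x. *)
pose S0 : set (A * R) := [set z | exists c (i : int) m,
  [/\ C c, m \is a Num.int & z = (c + x *~ i, t *~ i + m)]].
have [||f n _||a f _||h [_ hD hS]] := @divisible_extension A R setT integers S0.
- by split.
- exact: integers_subgroup.
- exists (f / n.+1%:R) => //.
  by rewrite -[_ *+ _]mulr_natr divfK// subrr; exact: rpred0.
- split; first by exists 0, 0, 0; rewrite !mulr0z !addr0; split => //; exact: gC.1.
  move=> _ _ [c [i [m [Cc mi ->]]]] [d [j [n [Cd ni ->]]]].
  exists (c - d), (i - j), (m - n); split; [exact: gC.2|exact: rpredB|].
  rewrite !mulrzBr; congr (_, _); last by rewrite /= opprD addrACA.
  by rewrite /= opprD addrACA.
- by [].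
- move=> f [c [i [m [Cc mi]]]] [cx ->]; apply: rpredD => //; apply: tC.
  have -> : x *~ i = - c by rewrite -[RHS]addr0 cx addrA addNr add0r.
  exact: subgroupN.
exists h; split => [//|c Cc|].
  rewrite -[h c]subr0; apply: hS; exists c, 0, 0.
  by rewrite !mulr0z !addr0; split => //; exact: rpred0.
apply: contra tint => hx; rewrite -[t](subKr (h x)); apply: rpredB => //.
apply: hS; exists 0, 1, 0; rewrite add0r addr0; split; [exact: gC.1|exact: rpred0|by []].
Qed.

(** Homomorphisms separating [x l] from [C l] form, on the union of the [C l], one
    homomorphism to the direct sum of countably many circles, since an element
    of [C l] is killed by all homomorphisms of index at least l.  Extending it as
    such, and not coordinatewise, keeps the finiteness at every element of the
    group. *)
Lemma triangular_system {R : realType} {A : zmodType} (C : nat -> set A) (x : nat -> A) :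
  (forall l, is_subgroup (C l)) -> (forall k l, (k <= l)%N -> C k `<=` C l) ->
  (forall l, C l.+1 (x l)) -> (forall l, ~ C l (x l)) ->
  exists chi : nat -> A -> R, [/\ forall j, torus_hom (chi j),
    forall a, exists N, forall j, (N <= j)%N -> chi j a \is a Num.int,
    forall l c, C l c -> chi l c \is a Num.int &
    forall l, chi l (x l) \isn't a Num.int].
Proof.
move=> gC Cmono Cx Cnx.
have [chi0 chi0P] := choice (fun l => @separating_torus_hom R A (C l) (x l) (gC l) (Cnx l)).
pose D : set (nat -> R) := [set f | exists N, forall j, (N <= j)%N -> f j \is a Num.int].
pose K : set (nat -> R) := [set f | forall j, f j \is a Num.int].
(* The homomorphism given by the chi0 j on the union of the C l. *)
pose S0 : set (A * (nat -> R)) := [set z |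
  [/\ exists l, C l z.1, D z.2 & forall j, z.2 j - chi0 j z.1 \is a Num.int]].
have hom0 j : torus_hom (chi0 j) by have [] := chi0P j.
have gD : is_subgroup D.
  split; first by exists 0%N => j _; exact: rpred0.
  move=> f g [m fm] [n gn]; exists (maxn m n) => j; rewrite geq_max => /andP[mj nj].
  by apply: rpredB; [exact: fm|exact: gn].
have gK : is_subgroup K.
  by split=> [j|f g fK gK j]; [exact: rpred0|apply: rpredB].
have [||f n [N fN]||||h [hD hadd hS]] := @divisible_extension A (nat -> R) D K S0 => //.
(* Values in Z are replaced by 0 before dividing, to keep finiteness. *)
- exists (fun j => if (N <= j)%N then 0 else f j / n.+1%:R).
    by exists N => j ->; exact: rpred0.
  move=> j; rewrite -[X in X \is a _]/((_ *+ n.+1) j - f j) natmulfctE /=.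
  case: ifPn => [Nj|_]; first by rewrite mul0rn sub0r rpredN; exact: fN.
  by rewrite -[_ *+ _]mulr_natr divfK// subrr rpred0.
- split; first by split; [exists 0%N; exact: (gC 0%N).1|exact: gD.1|by move=> j; rewrite /= sub0r rpredN; exact: torus_hom0].
  move=> [a f] [b g] [/= [k Ca] Df fa] [/= [l Cb] Dg gb]; split => /=.
  + exists (maxn k l); apply: (gC (maxn k l)).2.
      by apply: (Cmono k) Ca; exact: leq_maxl.
    by apply: (Cmono l) Cb; exact: leq_maxr.
  + exact: gD.2.
  + move=> j; have := rpredB (rpredB (fa j) (gb j)) (torus_homB a b (hom0 j)).
    rewrite (_ : _ - _ - _ = f j - g j - chi0 j (a - b))//; ring.
- by move=> a f [].
- by move=> f [/= _ Df fj] j; rewrite -[f j](subrK (chi0 j 0)); apply: rpredD => //; exact: torus_hom0.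
pose chi j a := h a j.
have chiC l c : C l c -> forall j, chi j c - chi0 j c \is a Num.int.
  move=> Clc j; apply: (hS c (chi0 ^~ c)); split => /=; [by exists l| |].
    exists l => k lk; case: (chi0P k) => _ + _; apply; exact: Cmono lk _ Clc.
  by move=> k; rewrite subrr rpred0.
exists chi; split.
- by move=> j a b; exact: hadd.
- exact: hD.
- move=> l c Clc; rewrite -[chi l c](subrK (chi0 l c)); apply: rpredD.
    exact: chiC Clc _.
  by case: (chi0P l) => _ + _; exact.
- move=> l; case: (chi0P l) => _ _; apply: contra => chix.
  rewrite -[chi0 l (x l)](subKr (chi l (x l))); apply: rpredB => //.
  exact: chiC (Cx l) _.
Qed.

(** * Recurrent systems on all noncompact groups *)

(** Indices are chosen one after the other.  Once finitely many are chosen, the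
    pigeonhole principle gives a difference g of two of the [x l] of energy at
    most 1 for these homomorphisms; the following indices are so large that the
    later homomorphisms vanish at g.  Moreover g is taken outside the subgroup of
    the elements killed by all [chi i] with i >= n, at stage n.  These open
    subgroups exhaust the group, so the elements g leave every compact set. *)
Lemma triangular_recurrent_system {R : realType} {A : topologicalZmodType}
    (W : set A) (x : nat -> A) (chi : nat -> A -> R) :
  nbhs (0 : A) W -> (forall j, torus_hom (chi j)) ->
  (forall a, exists N, forall j, (N <= j)%N -> chi j a \is a Num.int) ->
  (forall l c, W c -> chi l c \is a Num.int) ->
  (forall l, chi l (x l) \isn't a Num.int) ->
  (forall i l, (i < l)%N -> chi l (x i) \is a Num.int) ->
  exists psi : nat -> A -> R, recurrent_system psi.
Proof.
move=> nW chi_hom chi_ev chiW chi_x chi_lt.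
pose U n : set A := [set g | forall i, (n <= i)%N -> chi i g \is a Num.int].
(* A step extends the list s of chosen indices by m; g witnesses recurrence. *)
pose step (s : seq nat) (m : nat) := all (fun i => i < m)%N s /\
  exists g, [/\ ~ U (size s) g,
    \sum_(0 <= i < size s) 2 ^+ i * dist_int (chi (nth 0%N s i) g) <= 1 & U m g].
have stepE s : exists m, step s m.
  set n := size s.
  have [i [l [il close]]] := @dist_int_pigeonhole R n
    (fun r i => chi (nth 0%N s r) (x (n + i)%N)) (n * 2 ^ n).
  pose g := x (n + l)%N - x (n + i)%N.
  have [N gN] := chi_ev g.
  exists (maxn N (\max_(i <- s) i.+1)); split.
    by apply/allP => j js; rewrite leq_max (big_rem j)//= leq_maxl orbT.
  exists g; split.
  - move=> /(_ (n + l)%N (leq_addr _ _)) gint.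
    move: (chi_x (n + l)%N); apply/negP; rewrite negbK.
    have := torus_homB (x (n + l)%N) (x (n + i)%N) (chi_hom (n + l)%N); rewrite -/g => h.
    rewrite (_ : chi _ _ = chi (n + l)%N g + chi (n + l)%N (x (n + i)%N) -
      (chi (n + l)%N g - (chi (n + l)%N (x (n + l)%N) - chi (n + l)%N (x (n + i)%N)))); last by ring.
    by rewrite rpredB// rpredD// chi_lt// ltn_add2l.
  - rewrite big_mkord; apply: (@le_trans _ _ (\sum_(r < n) 2 ^+ n * (n * 2 ^ n).+1%:R^-1)).
      apply: ler_sum => r _; apply: ler_pM; rewrite ?exprn_ge0 ?dist_int_ge0//.
        by rewrite ler_weXn2l ?ler1n// ltnW.
      apply: le_trans (close r).
      by rewrite (dist_int_congr (torus_homB _ _ (chi_hom _))).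
    rewrite sumr_const card_ord -[_ *+ n]mulr_natl mulrA ler_pdivrMr// mul1r.
    by rewrite -natrX -natrM ler_nat.
  - by move=> j; rewrite geq_max => /andP[Nj _]; exact: gN.
have [next nextP] := choice stepE.
pose S := fix S k := if k is k'.+1 then rcons (S k') (next (S k')) else [::].
pose j k := next (S k).
have SE k : S k = mkseq j k by elim: k => [//|k IH]; rewrite mkseqS /= -IH.
have sizeS k : size (S k) = k by rewrite SE size_mkseq.
have j_lt i k : (i < k)%N -> (j i < j k)%N.
  move=> ik; have [/allP + _] := nextP (S k); apply.
  by rewrite SE; apply/mapP; exists i => //; rewrite mem_iota.
have j_ge k : (k <= j k)%N.
  by elim: k => [//|k IH]; exact: leq_ltn_trans IH (j_lt _ _ (ltnSn k)).
have Umono m n : (m <= n)%N -> U m `<=` U n.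
  by move=> mn g Um i ni; apply: Um; exact: leq_trans mn ni.
exists (fun k => chi (j k)); split => [k|g|e e0|k|].
- exact: chi_hom.
- have [N gN] := chi_ev g.
  apply: le_lt_trans (ltry _); apply: (@energy_le_partial _ _ _ _ N) => k Nk.
  exact/gN/(leq_trans Nk).
- apply: filterS nW => g Wg; apply: le_trans (_ : (0%:E <= _)%E); last by rewrite lee_fin ltW.
  have := @energy_le_partial R A (fun k => chi (j k)) g 0.
  by rewrite big_geq//; apply => k _; exact: chiW.
- have [n hn] := dist_int_quarter _ (chi_x (j k)).
  exists (x (j k) *+ n).
  by rewrite (dist_int_congr (torus_homMn _ _ (chi_hom _))).
- exists 1 => -[K /= Ksub [cK _]].
  have [n KU] : exists n, K `<=` U n.
    apply: compact_sub_nondecreasing => //.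
    move=> a Ka; have [N aN] := chi_ev a; exists N.
    apply: filterS (nbhs_translate a W nW) => b /= Wb i Ni.
    rewrite -[chi i b](subrK (chi i a)) rpredD//; last exact: aN.
    have h := torus_homB b a (chi_hom i).
    by rewrite -[_ - _](subKr (chi i (b - a))) rpredB// chiW.
  have [_ [g [ng sum1 Ug]]] := nextP (S n); rewrite sizeS in ng sum1.
  apply: ng; apply: KU; apply: Ksub => /=.
  apply: (le_trans (@energy_le_partial _ _ _ _ n _)).
    move=> k nk; apply: Ug.
    by move: nk; rewrite leq_eqVlt => /predU1P[->//|/j_lt/ltnW].
  rewrite lee_fin (le_trans _ sum1)// !big_nat; apply: ler_sum => i /= i_n.
  by rewrite SE nth_mkseq.
Qed.

(** The two cases are whether or not the group is generated by a compact set that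
    contains a given compact neighbourhood of 0. *)
Lemma noncompact_recurrent_system {R : realType} (A : topologicalZmodType) :
  locally_compact [set: A] -> ~ compact [set: A] ->
  exists chi : nat -> A -> R, recurrent_system chi.
Proof.
move=> lcA ncA.
have [V nV cV] : exists2 V : set A, nbhs (0 : A) V & compact V.
  have [V nV [cV _]] := lcA 0 I; exists V => //.
  by apply: (@filterS _ (nbhs (0 : A)) _ _ _ _ nV) => a; exact.
have [[W [cW VW genW]]|ngen] := pselect (exists W : set A,
    [/\ compact W, V `<=` W & forall a, generated W a]).
  (* A compact symmetric neighbourhood of 0 that generates A. *)
  pose W' : set A := W `|` (-%R @` W).
  have cW' : compact W'.
    apply: compactU => //; apply: continuous_compact => //.
    by apply: continuous_subspaceT; exact: opp_continuous.
  have nW' : nbhs (0 : A) W' by apply: filterS nV => a /VW; left.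
  have W'0 : W' 0 by exact: nbhs_singleton.
  have W'N a : W' a -> W' (- a).
    by move=> [Wa|[b Wb <-]]; [right; exists a|left; rewrite opprK].
  have genW' a : exists n, word_ball W' n a.
    apply: (genW a [set x | exists n, word_ball W' n x]); first exact: word_ball_subgroup.
    by move=> b Wb; exists 1%N; apply: word_ball1; left.
  have [c cdist] := undistorted_generator W' W'0 cW' nW' genW' ncA.
  have [phi [phiD phic phi_le]] := @dominated_homomorphism R A W' c genW' cdist.
  exact: real_recurrent_system W'0 W'N nW' genW' phiD phic phi_le.
have pickE (s : seq A) : exists a, ~ generated (V `|` [set` s]) a.
  apply: contrapT => nex; apply: ngen; exists (V `|` [set` s]); split.
  - by apply: compactU => //; apply: finite_compact; exact: finite_seq.
  - by move=> a; left.
  - by move=> a; apply: contrapT => na; apply: nex; exists a.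
have [pick pickP] := choice pickE.
pose S := fix S k := if k is k'.+1 then rcons (S k') (pick (S k')) else [::].
pose C l := generated (V `|` [set` S l]).
have Cmono k l : (k <= l)%N -> C k `<=` C l.
  move=> /subnK <-; elim: (l - k)%N => [//|n IH] a /IH.
  apply: generatedS => b [Vb|Sb]; [by left|right].
  by rewrite /= mem_rcons inE; apply/orP; right.
have Cpick l : C l.+1 (pick (S l)).
  by apply: sub_generated; right; rewrite /= mem_rcons inE eqxx.
have Cnpick l : ~ C l (pick (S l)) by exact: pickP.
have [chi [chi_hom chi_ev chiC chi_x]] := @triangular_system R A C _
  (fun l => generated_subgroup _) Cmono Cpick Cnpick.
apply: (triangular_recurrent_system (C 0%N) (fun l => pick (S l)) chi) => //.
- by apply: filterS nV => a Va; apply: sub_generated; left.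
- by move=> l c C0c; apply: chiC; exact: (Cmono 0%N).
- move=> i l il; apply: chiC; exact: Cmono il _ (Cpick i).
Qed.

(** * Measure-preserving rotations of the real line *)

Lemma lebesgue_measure_shift {R : realType} (t : R) (B : set R) :
  measurable B -> lebesgue_measure ((fun x => x + t) @^-1` B) = lebesgue_measure B.
Proof.
pose f : measurableTypeR R -> measurableTypeR R := fun x => x + t.
have mf : measurable_fun [set: measurableTypeR R] f by exact: measurable_funD.
pose F : {mfun measurableTypeR R >-> measurableTypeR R} := HB.pack f (isMeasurableFun.Build _ _ _ _ _ mf).
move=> mB; apply/esym.
apply: (@lebesgue_measure_unique R (pushforward lebesgue_measure F)) => // _ [[a b]] _ <-.
rewrite -[RHS]/(lebesgue_measure (f @^-1` `]a, b]%classic)).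
rewrite (_ : f @^-1` _ = `]a - t, b - t]%classic); last first.
  by apply/seteqP; split => x /=; rewrite !in_itv/= ltrBlDr lerBrDr.
rewrite !lebesgue_measure_itv/= !lte_fin ltrD2r; case: ifP => // _.
by rewrite -!EFinB; congr (_%:E); ring.
Qed.

(** The images of the pieces partition the line again, and each has the measure
    of its piece. *)
Lemma measure_preserving_piecewise_shift {R : realType} (T S : R -> R)
    (D : nat -> set R) (t : nat -> R) :
  cancel T S -> cancel S T -> (forall k, measurable (D k)) ->
  trivIset setT D -> (forall x, exists k, D k x) ->
  (forall k x, D k x -> T x = x + t k) ->
  forall B, measurable B ->
    measurable (T @^-1` B) /\ lebesgue_measure (T @^-1` B) = lebesgue_measure B.
Proof.
move=> TS ST mD tD covD TE B mB.
have msh s (C : set R) : measurable C -> measurable ((fun x => x + s) @^-1` C).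
  move=> mC; rewrite -[X in measurable X]setTI.
  by apply: (@measurable_funD _ _ _ _ id (cst s)) => //; exact: measurable_id.
(* E k is the image of D k under T. *)
pose E k := (fun x => x + - t k) @^-1` D k.
have EP k y : E k y <-> D k (S y).
  rewrite /E /=; split => [Dy|Dy].
    by have := TE _ _ Dy; rewrite subrK => <-; rewrite TS.
  by have := TE _ _ Dy; rewrite ST => ->; rewrite addrK.
have mE k : measurable (E k) by exact: msh.
pose P k := T @^-1` B `&` D k.
have PE k : P k = (fun x => x + t k) @^-1` (B `&` E k).
  apply/seteqP; split => x /=.
    by move=> [Bx Dx]; rewrite /E /= addrK -(TE _ _ Dx).
  by move=> [Bx]; rewrite /E /= addrK => Dx; split => //; rewrite /= (TE _ _ Dx).
have mP k : measurable (P k) by rewrite PE; apply: msh; exact: measurableI.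
have TB : T @^-1` B = \bigcup_k P k.
  apply/seteqP; split => x; last by move=> [k _ []].
  by move=> Bx; have [k Dx] := covD x; exists k.
have BE : B = \bigcup_k (B `&` E k).
  apply/seteqP; split => x; last by move=> [k _ []].
  by move=> Bx; have [k Dx] := covD (S x); exists k => //; split => //; apply/EP.
split; first by rewrite TB; exact: bigcupT_measurable.
rewrite TB [in RHS]BE !measure_bigcup//.
- by apply: eq_eseriesr => k _; rewrite PE; apply: lebesgue_measure_shift; exact: measurableI.
- by move=> k _; apply: measurableI; [exact: mB|exact: mE].
- by move=> i j _ _ [x [[_ /EP xi] [_ /EP xj]]]; apply: (tD i j) => //; exists (S x).
- by move=> k _; exact: mP.
- by move=> i j _ _ [x [[_ xi] [_ xj]]]; apply: (tD i j) => //; exists x.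
Qed.

Section Rotations.
Context {R : realType}.
Implicit Types (x y : R) (theta : nat -> R).

Definition fract x : R := x - (Num.floor x)%:~R.

Lemma frac_itv x : 0 <= fract x < 1.
Proof.
have := floor_itv x; rewrite rmorphD/= /fract => /andP[h1 h2].
by apply/andP; split; lra.
Qed.

Lemma frac_congr x y : x - y \is a Num.int -> fract x = fract y.
Proof.
move=> /intrP[m xy]; have -> : x = m%:~R + y by rewrite -xy subrK.
by rewrite /fract floorDzr ?intr_int// intrKfloor rmorphD/=; ring.
Qed.

(** Each interval between consecutive integers is a circle; the intervals [j, j+1)
    and [-j, -j+1) are rotated by [theta j]. *)
Definition rotation theta x : R :=
  (Num.floor x)%:~R + fract (x + theta `|Num.floor x|%N).

Lemma floor_rotation theta x : Num.floor (rotation theta x) = Num.floor x.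
Proof.
apply: floor_def; rewrite /rotation rmorphD/=.
have /andP[h1 h2] := frac_itv (x + theta `|Num.floor x|%N).
by apply/andP; split; lra.
Qed.

Lemma frac_rotation theta x :
  fract (rotation theta x) = fract (x + theta `|Num.floor x|%N).
Proof. by rewrite {1}/fract floor_rotation /rotation addrAC subrr add0r. Qed.

(** The rotations depend only on the classes of the angles modulo Z, so that
    homomorphisms to the circle give an action on the line by honest maps, not
    only up to null sets. *)
Lemma rotation_comp theta1 theta2 theta x :
  (forall j, theta j - theta1 j - theta2 j \is a Num.int) ->
  rotation theta1 (rotation theta2 x) = rotation theta x.
Proof.
move=> thetaE; rewrite {1}/rotation floor_rotation; congr (_ + _).
apply: frac_congr; rewrite /rotation; set j := `|_|%N.
have -> : (Num.floor x)%:~R + fract (x + theta2 j) + theta1 j - (x + theta j) =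
  (Num.floor x)%:~R - (Num.floor (x + theta2 j))%:~R - (theta j - theta1 j - theta2 j).
  by rewrite /fract; ring.
by apply: rpredB => //; apply: rpredB; exact: intr_int.
Qed.

Lemma rotation_id theta x : (forall j, theta j \is a Num.int) -> rotation theta x = x.
Proof.
move=> thetaP; rewrite /rotation (@frac_congr _ x) ?[_ + _ - x]addrAC ?subrr ?add0r//.
by rewrite /fract addrC subrK.
Qed.

(** The pieces are indexed by the integral part of a point and that of its
    translate, on which a rotation is a translation. *)
Lemma rotation_measure_preserving theta (B : set R) : measurable B ->
  measurable (rotation theta @^-1` B) /\
  lebesgue_measure (rotation theta @^-1` B) = lebesgue_measure B.
Proof.
pose D k : set R := if @pickle_inv (int * int)%type k is Some (i, m) then
  [set x | Num.floor x = i] `&` [set x | Num.floor (x + theta `|i|%N) = m] else set0.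
pose t k : R := if @pickle_inv (int * int)%type k is Some (i, m) then theta `|i|%N + i%:~R - m%:~R else 0.
have mfl (i : int) s : measurable [set x : R | Num.floor (x + s) = i].
  rewrite (_ : [set _ | _] = `[i%:~R - s, (i + 1)%:~R - s[%classic); first exact: measurable_itv.
  apply/seteqP; split => x /=; rewrite in_itv/= lerBlDr ltrBrDr -floor_eq => /eqP//.
have rotN theta1 : cancel (rotation theta1) (rotation (fun j => - theta1 j)).
  move=> x; rewrite (@rotation_comp _ _ (fun=> 0)); last by move=> j; rewrite sub0r opprK subrr rpred0.
  by rewrite rotation_id// => j; exact: rpred0.
apply: (@measure_preserving_piecewise_shift R _ (rotation (fun j => - theta j)) D t).
- exact: rotN.
- move=> x; have := rotN (fun j => - theta j) x.
  by rewrite (_ : (fun j => - - theta j) = theta)//; apply/funext => j; rewrite opprK.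
- move=> k; rewrite /D; case: pickle_inv => [[i m]|]; last exact: measurable0.
  apply: measurableI => //.
  by have := mfl i 0; under eq_set do rewrite addr0.
- apply/trivIsetP => k l _ _ kl; rewrite -subset0 => x [].
  rewrite /D; case Ek : (@pickle_inv _ k) => [[i m]|//] [/= xi xm].
  case El : (@pickle_inv _ l) => [[i' m']|//] [/= xi' xm'].
  have im : (i, m) = (i', m') by rewrite -xm -xm' -xi -xi'.
  move: kl; apply/negP; rewrite negbK.
  have := @pickle_invK (int * int)%type k; have := @pickle_invK (int * int)%type l.
  by rewrite Ek El /= => <- <-; rewrite im.
- move=> x; exists (pickle (Num.floor x, Num.floor (x + theta `|Num.floor x|%N))).
  by rewrite /D pickleK_inv.
- move=> k x; rewrite /D /t; case: pickle_inv => [[i m]|//] [/= <- <-].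
  by rewrite /rotation /fract; ring.
Qed.

End Rotations.

(** * The half-circle profile *)

Section Profile.
Context {R : realType}.
Implicit Types (x y : R) (theta c : nat -> R).
Local Notation mu := (@lebesgue_measure R).

Lemma measurable_rotation theta :
  measurable_fun [set: measurableTypeR R] (rotation theta : measurableTypeR R -> measurableTypeR R).
Proof. by move=> _ B mB; rewrite setTI; case: (rotation_measure_preserving theta B mB). Qed.

Definition profile c x : R :=
  if Num.floor x is Posz j then c j * (fract x < 2^-1)%R%:R else 0.

Lemma measurable_floor_eq (i : int) : measurable [set x : R | Num.floor x = i].
Proof.
rewrite (_ : [set _ | _] = `[i%:~R, (i + 1)%:~R[%classic); first exact: measurable_itv.
by apply/seteqP; split => x /=; rewrite in_itv/= -floor_eq => /eqP.
Qed.

Lemma measurable_frac_lt (r : R) : measurable [set x : R | fract x < r].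
Proof.
(* The integers are enumerated by the natural numbers, over which measures are additive. *)
pose E k : set R := if @pickle_inv int k is Some i then
  [set x | Num.floor x = i] `&` `]-oo, r + i%:~R[%classic else set0.
rewrite (_ : [set _ | _] = \bigcup_k E k).
  apply: bigcupT_measurable => k; rewrite /E; case: pickle_inv => [i|]; last exact: measurable0.
  by apply: measurableI; [exact: measurable_floor_eq|exact: measurable_itv].
apply/seteqP; split => x /=.
  move=> xr; exists (pickle (Num.floor x)); first exact: I.
  rewrite /E pickleK_inv; split; first by [].
  by rewrite /= in_itv/= -ltrBlDr.
move=> [k _]; rewrite /E; case: pickle_inv => // i [/= <-].
by rewrite in_itv/= -ltrBlDr.
Qed.

Lemma measurable_profile c : measurable_fun [set: measurableTypeR R] (profile c : measurableTypeR R -> R).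
Proof.
pose E k : set R := if @pickle_inv (int * bool)%type k is Some (i, b) then
  [set x | Num.floor x = i] `&` [set x | (fract x < 2^-1) = b] else set0.
have mE k : measurable (E k).
  rewrite /E; case: pickle_inv => [[i b]|]; last exact: measurable0.
  apply: measurableI; first exact: measurable_floor_eq.
  case: b; first exact: measurable_frac_lt.
  rewrite (_ : [set _ | _] = ~` [set x | fract x < 2^-1]).
    by apply: measurableC; exact: measurable_frac_lt.
  by apply/seteqP; split => x /=; [move=> ->|move/negP/negbTE].
have ET : [set: measurableTypeR R] = \bigcup_k E k.
  apply/seteqP; split => x // _.
  exists (pickle (Num.floor x, fract x < 2^-1)); first exact: I.
  by rewrite /E pickleK_inv.
rewrite ET; apply/measurable_fun_bigcup => // k.
case Ek : (@pickle_inv (int * bool)%type k) => [[i b]|]; last first.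
  by rewrite /E Ek; exact: measurable_fun_set0.
apply: (eq_measurable_fun (cst (if i is Posz j then c j * b%:R else 0))).
  by move=> x; rewrite inE /E Ek /profile => -[/= -> ->].
exact: measurable_cst.
Qed.

Definition half_swap (j : nat) (t : R) : set R :=
  [set x | Num.floor x = j%:Z /\ (fract (x + t) < 2^-1) <> (fract x < 2^-1)].

Lemma measurable_half_swap j t : measurable (half_swap j t).
Proof.
have mT : measurable [set x : R | fract (x + t) < 2^-1].
  have : measurable_fun [set: measurableTypeR R] (fun x : measurableTypeR R => x + t : measurableTypeR R).
    exact: measurable_funD.
  move=> /(_ measurableT _ (measurable_frac_lt 2^-1)).
  by rewrite setTI.
have mF := measurable_frac_lt 2^-1.
rewrite (_ : half_swap j t = [set x : R | Num.floor x = j%:Z] `&`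
  (([set x : R | fract (x + t) < 2^-1] `\` [set x : R | fract x < 2^-1]) `|`
   ([set x : R | fract x < 2^-1] `\` [set x : R | fract (x + t) < 2^-1]))).
  apply: measurableI; first exact: measurable_floor_eq.
  by apply: measurableU; exact: measurableD.
apply/seteqP; split => x /= [fx h]; split => //.
  by move: h; case: (fract x < _); case: (fract (x + t) < _) => // h; [right|left].
by case: h => -[]; case: (fract x < _); case: (fract (x + t) < _).
Qed.

(** If [t] is at distance at least 1/4 from the integers, the rotation moves a
    whole quarter of the circle out of the first half: the second quarter when
    the fractional part of [t] is at most 1/2, the first one otherwise. *)
Lemma half_swap_ge j t : 4^-1 <= dist_int t -> (4^-1%:E <= mu (half_swap j t))%E.
Proof.
move=> t4.
have [f1 f2] : 4^-1 <= fract t /\ fract t <= 3 / 4.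
  have := frac_itv t; have /(le_trans t4) := @dist_int_le R t (Num.floor t)%:~R (intr_int _ _).
  have /(le_trans t4) := @dist_int_le R t (Num.floor t + 1)%:~R (intr_int _ _).
  rewrite rmorphD/= /fract => h1 h2 /andP[h3 h4]; split.
    by rewrite ger0_norm in h2.
  by rewrite ltr0_norm in h1; lra.
have key (a b : R) : 0 <= a -> b <= 1 -> b - a = 4^-1 ->
    (forall y, a <= y < b -> (fract (y + fract t) < 2^-1) <> (y < 2^-1)) ->
    (4^-1%:E <= mu (half_swap j t))%E.
  move=> a0 b1 ab H.
  have -> : 4^-1%:E = mu `[j%:R + a, j%:R + b[%classic.
    rewrite lebesgue_measure_itv/= lte_fin ltrD2l ifT; last by rewrite -subr_gt0 ab; lra.
    by rewrite -EFinB -ab; congr (_%:E); ring.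
  apply: le_measure; rewrite ?inE; [exact: measurable_itv|exact: measurable_half_swap|].
  move=> x /=; rewrite in_itv/= => /andP[x1 x2].
  have fx : Num.floor x = j%:Z.
    by apply: floor_def; rewrite rmorphD/= -pmulrn; apply/andP; split; lra.
  have fr : fract x = x - j%:R by rewrite /fract fx -pmulrn.
  split => //; rewrite fr (_ : fract (x + t) = fract (x - j%:R + fract t)).
    by apply: H; apply/andP; split; lra.
  apply: frac_congr; rewrite /fract.
  rewrite (_ : _ - _ = j%:R + (Num.floor t)%:~R); last by ring.
  by rewrite rpredD ?natr_int ?intr_int.
have fracE (z : R) : 0 <= z < 1 -> fract z = z.
  by move=> z01; rewrite /fract (@floor_def _ z 0) ?subr0//; exact: z01.
have [t2|t2] := leP (fract t) 2^-1.
  apply: (key 4^-1 2^-1); [lra|lra|lra|move=> y /andP[y1 y2]].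
  rewrite fracE; last by apply/andP; split; lra.
  by rewrite y2 ltNge (_ : _ <= _ = true)//; apply/idP; lra.
apply: (key 0 4^-1); [lra|lra|lra|move=> y /andP[y1 y2]].
rewrite fracE; last by apply/andP; split; lra.
rewrite (_ : y < 2^-1 = true); last by apply/idP; lra.
by rewrite ltNge (_ : _ <= _ = true)//; apply/idP; lra.
Qed.

(** Only points within [dist_int t] of the endpoints or of the middle of the
    interval can change half. *)
Lemma half_swap_le j t : (mu (half_swap j t) <= (4 * dist_int t)%:E)%E.
Proof.
set d := dist_int t.
pose m : R := (Num.floor (t + 2^-1))%:~R.
have d0 : 0 <= d by exact: dist_int_ge0.
have dE : d = `|t - m| by [].
pose J : R := j%:R.
pose I1 : set R := `[J + 2^-1 - d, J + 2^-1 + d]%classic.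
pose I2 : set R := `[J, J + d]%classic.
pose I3 : set R := `[J + 1 - d, J + 1]%classic.
have mI : measurable I1 /\ measurable I2 /\ measurable I3 by do 2?[split]; exact: measurable_itv.
have mu_itv (a b : R) : a <= b -> mu `[a, b]%classic = (b - a)%:E.
  rewrite le_eqVlt lebesgue_measure_itv/= lte_fin => /predU1P[->|->//].
  by rewrite ltxx subrr.
have sub : half_swap j t `<=` I1 `|` (I2 `|` I3).
  move=> x [fx H]; apply: contrapT => /not_orP[n1 /not_orP[n2 n3]]; apply: H.
  have := floor_itv x; rewrite fx rmorphD/= -!pmulrn -/J => /andP[x1 x2].
  have fr : fract x = x - J by rewrite /fract fx -pmulrn.
  have h2 : J + d < x.
    by rewrite ltNge; apply/negP => h; apply: n2; rewrite /I2/= in_itv/= x1.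
  have h3 : x < J + 1 - d.
    by rewrite ltNge; apply/negP => h; apply: n3; rewrite /I3/= in_itv/= h ltW.
  have := ler_norm (t - m); have := ler_norm (- (t - m)); rewrite normrN -dE => e1 e2.
  have -> : fract (x + t) = x + t - m - J.
    have -> : fract (x + t) = fract (x + t - m - J).
      apply: frac_congr; rewrite (_ : _ - _ = m + J); last by ring.
      by rewrite rpredD ?natr_int ?intr_int.
    rewrite /fract (@floor_def _ _ 0) ?subr0//.
    by rewrite add0r; apply/andP; split; lra.
  rewrite fr; have [x12|x12] := ltP (x - J) 2^-1.
    apply/idP; have : x < J + 2^-1 - d.
      by rewrite ltNge; apply/negP => h; apply: n1; rewrite /I1/= in_itv/= h; lra.
    by move=> h; lra.
  apply/negbTE; rewrite -leNgt; have : J + 2^-1 + d < x.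
    by rewrite ltNge; apply/negP => h; apply: n1; rewrite /I1/= in_itv/= h andbT; lra.
  by move=> h; lra.
apply: (@le_trans _ _ (mu (I1 `|` (I2 `|` I3)))).
  apply: le_measure; rewrite ?inE//; first exact: measurable_half_swap.
  by apply: measurableU; [apply mI|apply: measurableU; apply mI].
have [mI1 [mI2 mI3]] := mI.
have h1 : (mu (I1 `|` (I2 `|` I3)) <= mu I1 + mu (I2 `|` I3))%E.
  by apply: measureU2 => //; exact: measurableU.
have h2 : (mu (I2 `|` I3) <= mu I2 + mu I3)%E by exact: measureU2.
apply: (le_trans h1); apply: (le_trans (leeD2l _ h2)).
rewrite /I1 /I2 /I3 !mu_itv; [|lra|lra|lra].
by rewrite -!EFinD lee_fin; lra.
Qed.

End Profile.

(** * Continuity of rotations on sets of finite measure *)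

Section IndicatorContinuity.
Context {R : realType} {I : Type} (F : set_system I) {FF : Filter F}.
Variable theta : I -> nat -> R.
Hypothesis theta0 : forall j (e : R), 0 < e ->
  \forall h \near F, dist_int (theta h j) <= e.
Local Notation mu := (@lebesgue_measure R).

(** At an integer this fails: a small rotation may send such a point close to the
    other end of its circle. *)
Lemma rotation_near (O : set R) (x : R) : open O -> O x -> (Num.floor x)%:~R < x ->
  \forall y \near x & h \near F, O (rotation (theta h) y).
Proof.
move=> oO Ox xj; set J : R := (Num.floor x)%:~R in xj *.
have [e e0 eO] : exists2 e : R, 0 < e & forall y, `|x - y| < e -> O y.
  by have /nbhs_ballP[e e0 eO] := open_nbhs_nbhs (conj oO Ox); exists e.
have := floor_itv x; rewrite rmorphD/= -/J => /andP[_ xJ1].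
(* The ball of radius d around x stays in O and does not meet the ends of the circle. *)
pose d := Num.min e (Num.min (x - J) (J + 1 - x)).
have d0 : 0 < d by rewrite /d !lt_min e0/= !subr_gt0 xj.
have [de dx1 dx2] : [/\ d <= e, d <= x - J & d <= J + 1 - x].
  by rewrite /d !ge_min !lexx ?orbT.
near=> y h => /=.
have xy : `|x - y| <= d / 4.
  by near: y; apply/nbhs_ballP; exists (d / 4) => [|y /ltW//]; rewrite /= divr_gt0.
have th : dist_int (theta h `|Num.floor x|%N) <= d / 4.
  by near: h; apply: theta0; rewrite divr_gt0.
set t := theta h `|Num.floor x|%N in th.
pose m : R := (Num.floor (t + 2^-1))%:~R.
have tm : `|t - m| <= d / 4 by [].
move: xy tm; rewrite !ler_norml => /andP[xy1 xy2] /andP[tm1 tm2].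
have fy : Num.floor y = Num.floor x.
  by apply: floor_def; rewrite rmorphD/= -/J; apply/andP; split; lra.
apply: eO; rewrite /rotation fy -/t -/J.
have -> : fract (y + t) = y + (t - m) - J.
  rewrite (_ : fract (y + t) = fract (y + (t - m) - J)).
    by rewrite /fract (@floor_def _ _ 0) ?subr0// add0r; apply/andP; split; lra.
  apply: frac_congr; rewrite (_ : _ - _ = m + J); last by ring.
  by rewrite rpredD ?intr_int.
by rewrite ltr_norml; apply/andP; split; lra.
Unshelve. all: by end_near. Qed.

(** Remove the integers, a null set, from [B] to get B', and squeeze B' between a
    compact K and an open W.  For h near 0 the rotation maps K into W, so that it
    can take a point of [B] out of [B] only if the point lies in B' \ K or its
    image in W \ B'.  The second bound follows as the rotation preserves the
    measure of [B]. *)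
Lemma rotation_indic_near (B : set R) (e : R) : measurable B -> (mu B < +oo)%E -> 0 < e ->
  \forall h \near F, (mu (B `\` rotation (theta h) @^-1` B) <= e%:E)%E /\
    (mu (rotation (theta h) @^-1` B `\` B) <= e%:E)%E.
Proof.
move=> mB Boo e0.
pose Z : set R := [set x | x = (Num.floor x)%:~R].
have cZ : countable Z.
  rewrite (_ : Z = \bigcup_(i in [set: int]) [set i%:~R]); last first.
    by apply/seteqP; split => x; [exists (Num.floor x)|move=> [i _ ->]; rewrite /Z /= intrKfloor].
  by apply: bigcup_countable => // i _; exact: countable1.
have Z0 : mu Z = 0%E by exact: countable_lebesgue_measure0.
have mZ : measurable Z.
  by apply: countable_measurable => // t; exact: measurable_set1.
pose B' := B `\` Z.
have mB' : measurable B' by exact: measurableD.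
have B'oo : (mu B' < +oo)%E.
  by apply: le_lt_trans Boo; apply: le_measure; rewrite ?inE//; exact: subDsetl.
have e2 : 0 < e / 2 by rewrite divr_gt0.
have [K [cK KB' Ke]] := @lebesgue_regularity_inner R B' (e / 2) mB' B'oo e2.
have [W [oW B'W We]] := @lebesgue_regularity_outer R B' (e / 2) mB' B'oo e2.
have mK : measurable K by exact: compact_measurable.
have mW : measurable W by exact: open_measurable.
have : \forall h \near F, K `<=` [set x | W (rotation (theta h) x)].
  move/compact_near_coveringP : cK; apply => x Kx; apply: rotation_near => //.
    exact/B'W/KB'.
  rewrite lt_neqAle floor_le andbT; apply/eqP => xZ.
  by have [_] := KB' _ Kx; apply.
apply: filterS => h KW.
set T := rotation (theta h).
have mT C : measurable C -> measurable (T @^-1` C).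
  by move=> mC; case: (rotation_measure_preserving (theta h) C mC).
have muT C : measurable C -> mu (T @^-1` C) = mu C.
  by move=> mC; case: (rotation_measure_preserving (theta h) C mC).
have H : (mu (B `\` T @^-1` B) <= e%:E)%E.
  have sub : B `\` T @^-1` B `<=` Z `|` ((B' `\` K) `|` T @^-1` (W `\` B')).
    move=> x [Bx TBx]; have [Zx|nZx] := pselect (Z x); [by left|right].
    have [Kx|nKx] := pselect (K x); [right|left; by split].
    by split; [exact: KW|move=> [/TBx]].
  have m1 : measurable (B' `\` K) by exact: measurableD.
  have m2 : measurable (T @^-1` (W `\` B')) by apply: mT; exact: measurableD.
  apply: (@le_trans _ _ (mu (Z `|` ((B' `\` K) `|` T @^-1` (W `\` B'))))).
    apply: le_measure; rewrite ?inE//; first by apply: measurableD => //; exact: mT.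
    by apply: measurableU => //; exact: measurableU.
  have h1 : (mu (Z `|` ((B' `\` K) `|` T @^-1` (W `\` B'))) <=
      mu Z + mu ((B' `\` K) `|` T @^-1` (W `\` B')))%E.
    by apply: measureU2 => //; exact: measurableU.
  apply: (le_trans h1); rewrite Z0 add0e.
  have h2 : (mu ((B' `\` K) `|` T @^-1` (W `\` B')) <=
      mu (B' `\` K) + mu (T @^-1` (W `\` B')))%E by exact: measureU2.
  apply: (le_trans h2); rewrite muT; last exact: measurableD.
  by rewrite [e]splitr EFinD; apply: leeD; exact: ltW.
split => //.
have TBoo : (mu (T @^-1` B) < +oo)%E by rewrite muT.
have e1 : mu (T @^-1` B `\` B) = (mu (T @^-1` B) - mu (T @^-1` B `&` B))%E.
  by apply: measureD => //; exact: mT.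
have e3 : mu (B `\` T @^-1` B) = (mu B - mu (B `&` T @^-1` B))%E.
  by apply: measureD => //; exact: mT.
by rewrite e1 muT// setIC -e3.
Qed.

End IndicatorContinuity.

(** * Continuity of rotations in L1 *)

Lemma integral_rotation {R : realType} (theta : nat -> R) (f : R -> \bar R) :
  measurable_fun [set: R] f -> (forall x, (0 <= f x)%E) ->
  (\int[@lebesgue_measure R]_x f (rotation theta x) = \int[@lebesgue_measure R]_x f x)%E.
Proof.
move=> mf f0.
have := @ge0_integral_pushforward _ _ _ _ R _ (measurable_rotation theta)
  (@lebesgue_measure R) setT f measurableT mf (fun x _ => f0 x).
rewrite preimage_setT => <-.
apply: eq_measure_integral => [|mr B mB _]; first exact: measurable_rotation.
by case: (rotation_measure_preserving theta B mB).
Qed.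

Import HBSimple.

Section L1Continuity.
Context {R : realType} {I : Type} (F : set_system I) {FF : Filter F}.
Variable theta : I -> nat -> R.
Hypothesis theta0 : forall j (e : R), 0 < e ->
  \forall h \near F, dist_int (theta h j) <= e.
Local Notation mu := (@lebesgue_measure R).
Implicit Types v w : R -> R.

(** Strong continuity at the limit of [F] of the translates of [v] in L1. *)
Definition L1_continuous v := measurable_fun [set: R] v /\
  forall e : R, 0 < e -> \forall h \near F,
    (\int[mu]_x `|v (rotation (theta h) x) - v x|%:E <= e%:E)%E.

Lemma measurable_comp_rotation h v : measurable_fun [set: R] v ->
  measurable_fun [set: R] (fun x => v (rotation (theta h) x)).
Proof. by move=> mv; exact: measurableT_comp mv (measurable_rotation _). Qed.

Lemma measurable_norm_sub v w : measurable_fun [set: R] v -> measurable_fun [set: R] w ->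
  measurable_fun [set: R] (fun x => `|v x - w x|%:E).
Proof.
move=> mv mw; apply/measurable_EFinP; apply: measurableT_comp => //.
exact: measurable_funB.
Qed.

Lemma L1_continuousD v w : L1_continuous v -> L1_continuous w ->
  L1_continuous (fun x => v x + w x).
Proof.
move=> [mv cv] [mw cw]; split; first exact: measurable_funD.
move=> e e0; have e2 : 0 < e / 2 by rewrite divr_gt0.
apply: filterS2 (cv _ e2) (cw _ e2) => h hv hw.
have mvr := measurable_comp_rotation h _ mv.
have mwr := measurable_comp_rotation h _ mw.
apply: (@le_trans _ _ (\int[mu]_x (`|v (rotation (theta h) x) - v x|%:E +
    `|w (rotation (theta h) x) - w x|%:E))%E).
  apply: ge0_le_integral => //.
  - apply: measurable_norm_sub; exact: measurable_funD.
  - by apply: emeasurable_funD; exact: measurable_norm_sub.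
  - move=> x _; rewrite -EFinD lee_fin.
    by rewrite opprD addrACA ler_normD.
rewrite ge0_integralD//; [|exact: measurable_norm_sub|exact: measurable_norm_sub].
by rewrite [e]splitr EFinD; apply: leeD.
Qed.

Lemma L1_continuous_indic (k : R) (B : set R) : measurable B ->
  (k != 0 -> (mu B < +oo)%E) -> L1_continuous (fun x => k * \1_B x).
Proof.
move=> mB Boo; split; first by apply: measurable_funM => //; exact: measurable_indic.
move=> e e0; have [->|k0] := eqVneq k 0.
  near=> h; rewrite integral0_eq ?lee_fin ?ltW// => x _.
  by rewrite !mul0r subrr normr0.
have k_gt0 : 0 < `|k| by rewrite normr_gt0.
have ek : 0 < e / `|k| / 2 by rewrite !divr_gt0.
apply: filterS (rotation_indic_near F theta theta0 B _ mB (Boo k0) ek) => h [h1 h2].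
set T := rotation (theta h) in h1 h2 *.
have mTB : measurable (T @^-1` B) by case: (rotation_measure_preserving (theta h) B mB).
have mD1 : measurable (B `\` T @^-1` B) by exact: measurableD.
have mD2 : measurable (T @^-1` B `\` B) by exact: measurableD.
have -> : (\int[mu]_x `|k * \1_B (T x) - k * \1_B x|%:E =
  \int[mu]_x (`|k|%:E * (\1_(B `\` T @^-1` B) x)%:E + `|k|%:E * (\1_(T @^-1` B `\` B) x)%:E))%E.
  apply: eq_integral => x _; rewrite -!EFinM -EFinD -mulrDr -mulrBr normrM.
  congr (_ * _)%:E; rewrite !indicE !in_setD.
  rewrite (_ : (x \in T @^-1` B) = (T x \in B)); last by apply/idP/idP; rewrite !inE.
  by case: (T x \in B); case: (x \in B); rewrite /= ?subrr ?subr0 ?sub0r ?normrN ?normr0 ?normr1 ?addr0 ?add0r.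
rewrite ge0_integralD//; last 2 first.
  by apply/measurable_EFinP; apply: measurable_funM => //; exact: measurable_indic.
  by apply/measurable_EFinP; apply: measurable_funM => //; exact: measurable_indic.
rewrite !ge0_integralZl_EFin//; try by apply/measurable_EFinP; exact: measurable_indic.
rewrite !integral_indic// !setIT -ge0_muleDr//.
rewrite muleC -lee_pdivlMr//.
have -> : (e%:E * (`|k|)^-1%:E)%E = ((e / `|k| / 2)%:E + (e / `|k| / 2)%:E)%E.
  by rewrite -EFinD -splitr EFinM.
exact: leeD.
Unshelve. all: by end_near. Qed.

(** Rotations are isometries of L1, so the functions whose translates vary
    continuously form a closed set. *)
Lemma L1_continuous_approx v :
  measurable_fun [set: R] v ->
  (forall e : R, 0 < e -> exists w, L1_continuous w /\
    (\int[mu]_x `|v x - w x|%:E <= e%:E)%E) -> L1_continuous v.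
Proof.
move=> mv appr; split => // e e0; have e3 : 0 < e / 3 by rewrite divr_gt0.
have [w [[mw cw] vw]] := appr _ e3.
apply: filterS (cw _ e3) => h hw.
have mvr := measurable_comp_rotation h _ mv.
have mwr := measurable_comp_rotation h _ mw.
set T := rotation (theta h) in hw mvr mwr *.
have vwr : (\int[mu]_x `|v (T x) - w (T x)|%:E <= (e / 3)%:E)%E.
  have := @integral_rotation R (theta h) (fun x => `|v x - w x|%:E) (measurable_norm_sub _ _ mv mw).
  by move=> -> // x; rewrite lee_fin.
apply: (@le_trans _ _ (\int[mu]_x (`|v (T x) - w (T x)|%:E + (`|w (T x) - w x|%:E +
    `|v x - w x|%:E)))%E).
  apply: ge0_le_integral => //.
  - exact: measurable_norm_sub.
  - by apply: emeasurable_funD; [|apply: emeasurable_funD]; exact: measurable_norm_sub.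
  - move=> x _; rewrite -!EFinD lee_fin.
    rewrite (_ : v (T x) - v x = (v (T x) - w (T x)) + ((w (T x) - w x) + (w x - v x))); last by ring.
    apply: (le_trans (ler_normD _ _)); rewrite lerD2l.
    by rewrite (distrC (v x)) ler_normD.
rewrite ge0_integralD//; [|exact: measurable_norm_sub|by move=> x _; rewrite adde_ge0|
  by apply: emeasurable_funD; exact: measurable_norm_sub].
rewrite ge0_integralD//; [|exact: measurable_norm_sub|exact: measurable_norm_sub].
have -> : e%:E = ((e / 3)%:E + ((e / 3)%:E + (e / 3)%:E))%E.
  by rewrite -!EFinD; congr (_%:E); lra.
by rewrite leeD// leeD.
Qed.

(** Approximate [v] by a simple function, a finite combination of indicators of
    sets which have finite measure, except for the level set of the value 0. *)
Lemma integrable_L1_continuous v : mu.-integrable [set: R] (EFin \o v) ->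
  L1_continuous v.
Proof.
move=> iv; have mv : measurable_fun [set: R] v.
  by case/integrableP : iv => /measurable_EFinP.
apply: L1_continuous_approx => // e e0.
have [g [ig _ gv]] := approximation_sfun_integrable measurableT iv.
have [n gn] : exists n, (\int[mu]_x `|v x - g n x|%:E <= e%:E)%E.
  have /fine_cvgP[fin /cvgrPdist_le/(_ _ e0) close] := gv.
  have [n [nfin nclose]] := filter_ex (filterI fin close); exists n.
  rewrite -[leLHS](fineK nfin) lee_fin; move: nclose.
  by rewrite /= sub0r normrN; apply: le_trans; exact: ler_norm.
exists (g n); split => //.
have /= mg (y : R) : measurable (g n @^-1` [set y]) by apply: measurable_funPTI; exact: measurable_set1.
have goo (y : R) : y != 0 -> (mu (g n @^-1` [set y]) < +oo)%E.
  rewrite -normr_gt0 => y0; have /integrableP[mgn gnoo] := ig n.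
  have := @le_integral_abse _ _ R mu setT measurableT (EFin \o g n) `|y| mgn y0.
  rewrite setTI => /le_lt_trans/(_ gnoo) h.
  have : (`|y|%:E * mu (g n @^-1` [set y]) < +oo)%E.
    apply: le_lt_trans h; rewrite lee_pmul2l ?lte_fin//; apply: le_measure; rewrite ?inE//.
      rewrite -[X in measurable X]setTI; apply: emeasurable_fun_c_infty => //.
      exact: measurableT_comp.
    by move=> x /= ->.
  by rewrite !ltey; apply: contra => /eqP ->; rewrite gt0_muley// lte_fin.
have sumL (s : seq R) : L1_continuous (fun x => \sum_(y <- s) y * \1_(g n @^-1` [set y]) x).
  elim: s => [|y s IH].
    rewrite (_ : (fun x => _) = (fun x => 0 * \1_set0 x)).
      by apply: L1_continuous_indic => //; rewrite eqxx.
    by apply/funext => x; rewrite big_nil mul0r.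
  rewrite (_ : (fun x => _) = (fun x => y * \1_(g n @^-1` [set y]) x +
      \sum_(z <- s) z * \1_(g n @^-1` [set z]) x)).
    by apply: L1_continuousD => //; apply: L1_continuous_indic; [exact: mg|exact: goo].
  by apply/funext => x; rewrite big_cons.
have := sumL (finmap.enum_fset (fset_set (range (g n)))).
congr L1_continuous; apply/funext => x.
by rewrite fimfunE fsbig_finite//; exact: fimfunP.
Qed.

End L1Continuity.

(** * The Mazur map and continuity of rotations in Lp *)

Section MazurMap.
Context {R : realType} (p : R).
Hypothesis p1 : 1 <= p.

Let p0 : 0 < p. Proof. exact: lt_le_trans p1. Qed.

Lemma powR_homo (x y : R) : 0 <= x -> x <= y -> x `^ p <= y `^ p.
Proof.
move=> x0 xy; apply: ge0_ler_powR => //; first exact: ltW.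
by rewrite nnegrE (le_trans x0 xy).
Qed.

(** Write x ^ p as x * x ^ (p - 1) and bound the second factor by
    (x + y) ^ (p - 1). *)
Lemma powR_superadditive (x y : R) : 0 <= x -> 0 <= y ->
  x `^ p + y `^ p <= (x + y) `^ p.
Proof.
move=> x0 y0; rewrite -(mulr_powRB1 x0 p0) -(mulr_powRB1 y0 p0).
rewrite -(mulr_powRB1 (addr_ge0 x0 y0) p0) mulrDl.
have pB : 0 <= p - 1 by rewrite subr_ge0.
have xy0 := addr_ge0 x0 y0.
by apply: lerD; rewrite ler_wpM2l//; apply: ge0_ler_powR => //;
  rewrite ?lerDl ?lerDr.
Qed.

(** The Mazur map a |-> sign(a) |a| ^ p, which carries Lp to L1.  As a difference
    of powers of the positive and negative parts it is visibly measurable. *)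
Definition mazur (a : R) : R := (Num.max a 0) `^ p - (Num.max (- a) 0) `^ p.

Lemma mazur_ge0 a : 0 <= a -> mazur a = a `^ p.
Proof.
move=> a0; rewrite /mazur (max_l a0) (@max_r _ _ (- a)) ?oppr_le0//.
by rewrite powR0 ?subr0// gt_eqF.
Qed.

Lemma mazurN a : mazur (- a) = - mazur a.
Proof. by rewrite /mazur opprK opprB. Qed.

Lemma normr_mazur a : `|mazur a| = `|a| `^ p.
Proof.
have [a0|a0] := leP 0 a; first by rewrite mazur_ge0// !ger0_norm// powR_ge0.
have Na0 : 0 <= - a by rewrite oppr_ge0 ltW.
by rewrite (ltr0_norm a0) -{1}[a]opprK mazurN normrN mazur_ge0// ger0_norm ?powR_ge0.
Qed.

Lemma measurable_mazur : measurable_fun [set: R] mazur.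
Proof.
have mpow (f : R -> R) : measurable_fun [set: R] f -> measurable_fun [set: R] (fun x => f x `^ p).
  by move=> mf; exact: (measurableT_comp (measurable_powR p)).
apply: measurable_funB; apply: mpow; apply: measurable_maxr => //.
Qed.

Lemma powR_addr_le (x y : R) : 0 <= x -> 0 <= y ->
  (x + y) `^ p <= 2 `^ p * (x `^ p + y `^ p).
Proof.
move=> x0 y0; apply: (@le_trans _ _ ((2 * Num.max x y) `^ p)).
  apply: powR_homo; first exact: addr_ge0.
  by rewrite mulr_natl mulr2n lerD// le_max lexx ?orbT.
rewrite powRM ?le_max ?x0// ler_wpM2l ?powR_ge0//.
by have [_|_] := leP x y; rewrite ?lerDr ?lerDl powR_ge0.
Qed.

(** The inverse of the Mazur map is Hoelder continuous of exponent 1/p.  For arguments of the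
    same sign this is superadditivity of the p-th power; for opposite signs the
    difference is a sum of absolute values. *)
Lemma mazur_inequality a b : `|a - b| `^ p <= 2 `^ p * `|mazur a - mazur b|.
Proof.
have ge1 : 1 <= 2 `^ p.
  have e1 : 1 `^ p = 1 :> R by rewrite powR1.
  by rewrite -[leLHS]e1; apply: powR_homo => //; rewrite ler1n.
wlog ab : a b / b <= a.
  move=> H; have [ba|/ltW ab] := leP b a; first exact: H.
  by rewrite distrC [`|mazur a - _|]distrC; exact: H.
have same c d : 0 <= d -> d <= c -> `|c - d| `^ p <= 2 `^ p * `|mazur c - mazur d|.
  move=> d0 dc; have c0 := le_trans d0 dc.
  rewrite !mazur_ge0// ger0_norm ?subr_ge0//.
  have := @powR_superadditive (c - d) d; rewrite subr_ge0 subrK => /(_ dc d0) h.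
  apply: (@le_trans _ _ `|c `^ p - d `^ p|).
    by rewrite (le_trans _ (ler_norm _))// lerBrDr.
  by rewrite ler_peMl.
have [b0|b0] := leP 0 b; first exact: same.
have Nb0 : 0 <= - b by rewrite oppr_ge0 ltW.
have [a0|a0] := leP a 0.
  have := same (- b) (- a); rewrite oppr_ge0 lerN2 => /(_ a0 ab).
  by rewrite !mazurN !opprK (addrC (- b)) (addrC (- mazur b)).
rewrite -[b]opprK mazurN opprK opprK !mazur_ge0//; last exact: ltW.
set c := - b in Nb0 *; have {}a0 := ltW a0.
rewrite !ger0_norm ?addr_ge0 ?powR_ge0//.
exact: powR_addr_le.
Qed.

End MazurMap.

(** The p-th power of the Lp-norm. *)
Definition p_energy {R : realType} (p : R) (f : R -> R) : \bar R :=
  (\int[@lebesgue_measure R]_x (`|f x| `^ p)%:E)%E.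

Lemma measurable_powR_norm {R : realType} (p : R) (f : R -> R) :
  measurable_fun [set: R] f -> measurable_fun [set: R] (fun x => (`|f x| `^ p)%:E).
Proof.
move=> mf; apply/measurable_EFinP.
apply: (measurableT_comp (measurable_powR p)).
exact: measurableT_comp.
Qed.

Lemma p_energy_rotation {R : realType} (p : R) (theta : nat -> R) (f : R -> R) :
  measurable_fun [set: R] f -> p_energy p (fun x => f (rotation theta x)) = p_energy p f.
Proof.
move=> mf; apply: (@integral_rotation R theta (fun x => (`|f x| `^ p)%:E)).
  exact: measurable_powR_norm.
by move=> x; rewrite lee_fin powR_ge0.
Qed.

(** Rotations commute with the Mazur map, which reduces Lp to L1. *)
Lemma Lp_rotation_continuous {R : realType} {I : Type} (F : set_system I) {FF : Filter F}
    (theta : I -> nat -> R) (p : R) (u : R -> R) :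
  1 <= p ->
  (forall j (e : R), 0 < e -> \forall h \near F, dist_int (theta h j) <= e) ->
  measurable_fun [set: R] u -> (p_energy p u < +oo)%E ->
  forall e : R, 0 < e -> \forall h \near F,
    (p_energy p (fun x => u (rotation (theta h) x) - u x)%R <= e%:E)%E.
Proof.
move=> p1 theta0 mu_ uoo e e0.
pose v x := mazur p (u x).
have mv : measurable_fun [set: R] v by exact: measurableT_comp (measurable_mazur p) mu_.
have iv : (@lebesgue_measure R).-integrable [set: R] (EFin \o v).
  apply/integrableP; split; first exact/measurable_EFinP.
  apply: le_lt_trans uoo; rewrite le_eqVlt; apply/orP; left; apply/eqP.
  by apply: eq_integral => x _; rewrite /= normr_mazur.
have [_ cv] := integrable_L1_continuous F theta theta0 _ iv.
have c0 : 0 < 2 `^ p :> R by rewrite powR_gt0.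
have ec : 0 < e / 2 `^ p by rewrite divr_gt0.
apply: filterS (cv _ ec) => h hv.
have mur : measurable_fun [set: R] (fun x => u (rotation (theta h) x)).
  exact: (measurable_comp_rotation theta h _ mu_).
have mvr : measurable_fun [set: R] (fun x => v (rotation (theta h) x)).
  exact: (measurable_comp_rotation theta h _ mv).
apply: (@le_trans _ _ (\int[@lebesgue_measure R]_x ((2 `^ p)%:E * `|v (rotation (theta h) x) - v x|%:E))%E).
  apply: ge0_le_integral => //.
  - by apply: measurable_powR_norm; exact: measurable_funB.
  - by apply: measurable_funeM; exact: measurable_norm_sub.
  - by move=> x _; rewrite -EFinM lee_fin mazur_inequality.
rewrite ge0_integralZl_EFin ?powR_ge0//; last exact: measurable_norm_sub.
by rewrite -lee_pdivlMl// -EFinM mulrC.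
Qed.

(** * The displacement of the profile *)

Section Displacement.
Context {R : realType} (p : R).
Hypothesis p1 : 1 <= p.
Local Notation mu := (@lebesgue_measure R).

(** The p-th root makes the energy of the displacement independent of p. *)
Definition weight (j : nat) : R := (2 ^+ j) `^ p^-1.

(** The formal coboundary of the profile, which itself is not in Lp. *)
Definition displacement (theta : nat -> R) (x : R) : R :=
  profile weight (rotation theta x) - profile weight x.

Lemma measurable_displacement theta : measurable_fun [set: R] (displacement theta).
Proof.
apply: measurable_funB; last exact: measurable_profile.
exact: (measurableT_comp (measurable_profile weight) (measurable_rotation theta)).
Qed.

Lemma norm_displacement theta j x : `|Num.floor x|%N = j ->
  `|displacement theta x| `^ p = 2 ^+ j * \1_(half_swap j (theta j)) x.
Proof.
have p0 : p != 0 by rewrite gt_eqF// (lt_le_trans _ p1).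
rewrite /displacement /profile floor_rotation frac_rotation indicE.
case fx : (Num.floor x) => [k|k] /= xj; last first.
  rewrite subr0 normr0 powR0// memNset ?mulr0// => -[/=].
  by rewrite fx.
rewrite xj in fx *.
have wp : `|weight j| `^ p = 2 ^+ j.
  by rewrite ger0_norm ?powR_ge0// /weight -powRrM mulVf// powRr1// exprn_ge0.
rewrite -mulrBr normrM powRM// wp; congr (_ * _).
have [eqb|neqb] := eqVneq (fract (x + theta j) < 2^-1) (fract x < 2^-1).
  rewrite eqb subrr normr0 powR0// memNset// => -[_]; exact.
rewrite mem_set; last by split => //; exact/eqP.
by move: neqb; case: (fract x < _); case: (fract _ < _) => //= _;
  rewrite ?subr0 ?sub0r ?normrN normr1 powR1.
Qed.

Lemma p_energy_displacement theta : p_energy p (displacement theta) =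
  (\sum_(0 <= j <oo) (2 ^+ j)%:E * mu (half_swap j (theta j)))%E.
Proof.
(* For j > 0 this is the union of two intervals; the negative one contributes nothing. *)
pose P (j : nat) : set R := [set x | `|Num.floor x|%N = j].
have mP j : measurable (P j).
  rewrite (_ : P j = [set x | Num.floor x = j%:Z] `|` [set x | Num.floor x = - j%:Z]).
    by apply: measurableU; exact: measurable_floor_eq.
  apply/seteqP; split => x; rewrite /P /=.
    by case: (Num.floor x) => k /= <-; [left|right].
  by move=> [->|->]; rewrite ?abszN.
have PT : [set: R] = \bigcup_j P j.
  by apply/seteqP; split => // x _; exists `|Num.floor x|%N.
rewrite /p_energy PT ge0_integral_bigcup//.
- apply: eq_eseriesr => j _.
  transitivity (\int[mu]_(x in P j) ((2 ^+ j)%:E * (\1_(half_swap j (theta j)) x)%:E))%E.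
    by apply: eq_integral => x; rewrite inE => /norm_displacement ->.
  have mhs : measurable (half_swap j (theta j)) by exact: measurable_half_swap.
  rewrite (@ge0_integralZl_EFin _ _ _ mu (P j) (mP j) (EFin \o \1_(half_swap j (theta j))))//.
  - transitivity ((2 ^+ j)%:E * mu (half_swap j (theta j) `&` P j))%E.
      by congr (_ * _)%E; exact: (@integral_indic _ _ _ mu (P j) (mP j) _ mhs).
    congr (_ * mu _)%E; apply: setIidl => x [fx _].
    by rewrite /P /= fx.
  - by move=> x _; rewrite lee_fin indicE ler0n.
  - by apply/measurable_EFinP; exact: measurable_indic.
- by rewrite -PT; apply: measurable_powR_norm; exact: measurable_displacement.
- by apply/trivIsetP => i j _ _ ij; rewrite -subset0 => x [/= xi xj]; move: ij; rewrite -xi -xj eqxx.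
Qed.

Lemma p_energy_displacement_ge theta j : 4^-1 <= dist_int (theta j) ->
  ((2 ^+ j / 4)%:E <= p_energy p (displacement theta))%E.
Proof.
move=> t4; rewrite p_energy_displacement.
have ge0 k : (0 <= (2 ^+ k)%:E * mu (half_swap k (theta k)))%E by rewrite mule_ge0// lee_fin exprn_ge0.
apply: le_trans (nneseries_lim_ge j.+1 (fun k _ _ => ge0 k)).
rewrite big_nat_recr//= (le_trans _ (leeDr _ _)) ?sume_ge0//.
by rewrite EFinM lee_pmul2l ?lte_fin ?exprn_gt0// half_swap_ge.
Qed.

Lemma p_energy_displacement_le (A : zmodType) (chi : nat -> A -> R) g :
  (p_energy p (displacement (chi ^~ g)) <= 4%:E * energy chi g)%E.
Proof.
rewrite p_energy_displacement -nneseriesZl//; last first.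
  by move=> j _; rewrite lee_fin mulr_ge0 ?dist_int_ge0// exprn_ge0.
apply: lee_nneseries => [j _ _|j _].
  by rewrite mule_ge0// lee_fin exprn_ge0.
rewrite -EFinM mulrCA EFinM lee_pmul2l ?lte_fin ?exprn_gt0//.
exact: half_swap_le.
Qed.

End Displacement.

(** * The affine action on Lp *)

(** Rotations preserve measure, so preimages of null sets are null. *)
Lemma ae_rotation {R : realType} (theta : nat -> R) (P : R -> Prop) :
  {ae @lebesgue_measure R, forall x, P x} ->
  {ae @lebesgue_measure R, forall x, P (rotation theta x)}.
Proof.
move=> [N [mN N0 PN]]; exists (rotation theta @^-1` N).
have [mTN muTN] := rotation_measure_preserving theta N mN.
split => //; first by rewrite [LHS]muTN.
by move=> x nP; exact: PN.
Qed.

(** The general instance does not unify with the measurable structure that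
    Lebesgue measure carries on the real line. *)
#[local] Instance lebesgue_ae_filter {R : realType} :
  Filter (nbhs (almost_everywhere (@lebesgue_measure R))).
Proof. exact: (ae_filter_ringOfSetsType (@lebesgue_measure R)). Qed.

Section Lp.
Context {R : realType} (p : R) (pE1 : (1 <= p%:E)%E).
Local Notation mu := (@lebesgue_measure R).
Local Notation Lp := (LspaceType mu pE1).
Implicit Types (u v : Lp) (f : R -> R).

Let p1 : 1 <= p. Proof. by rewrite -lee_fin. Qed.
Let p0 : 0 < p. Proof. exact: lt_le_trans p1. Qed.

(** The coercion from Lp classes to functions, with the real line as domain. *)
Definition Lp_fun u : R -> R := u.

Lemma measurable_Lp_fun u : measurable_fun [set: R] (Lp_fun u).
Proof. exact: (@measurable_funPT _ _ _ _ (Lspace_repr u)). Qed.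

Lemma Lnorm_p_energy f : ('N[mu]_(p%:E)[EFin \o f] `^ p)%E = p_energy p f.
Proof. by rewrite powR_Lnorm// gt_eqF. Qed.

Lemma mem_Lfun_p_energy f : measurable_fun [set: R] f -> (p_energy p f < +oo)%E ->
  f \in Lfun mu p%:E.
Proof.
move=> mf foo; rewrite inE; apply/andP; split; rewrite inE//=.
rewrite /finite_norm ltey; apply: contraTneq foo => N.
by rewrite -Lnorm_p_energy N poweRyr ?gt_eqF// ltxx.
Qed.

Lemma p_energy_normE u f : measurable_fun [set: R] f -> Lp_fun u = f %[ae mu] ->
  p_energy p f = (`|u| `^ p)%:E.
Proof.
move=> mf uf; rewrite -Lnorm_p_energy -(@ae_eq_Lnorm _ _ R mu p%:E pE1 (Lp_fun u) f (measurable_Lp_fun u) mf uf).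
rewrite Lspace_normrE -poweR_EFin fineK//.
by rewrite ge0_fin_numE ?Lnorm_ge0//; exact: (@Lfunction_finite _ _ _ _ _ _ (Lspace_repr u)).
Qed.

Lemma p_energy_Lp_norm u : p_energy p (Lp_fun u) = (`|u| `^ p)%:E.
Proof. by apply: p_energy_normE; [exact: measurable_Lp_fun|exact: ae_eq_refl]. Qed.

Lemma p_energy_Lp_fun u : (p_energy p (Lp_fun u) < +oo)%E.
Proof. by rewrite p_energy_Lp_norm ltry. Qed.

Lemma Lp_funB u v : Lp_fun (u - v) = (fun x => Lp_fun u x - Lp_fun v x) %[ae mu].
Proof.
rewrite -scaleN1r; apply: filterS2 (Lspace_addP u (-1 *: v)) (Lspace_scaleP (-1) v).
move=> x /= h1 h2 _; rewrite /Lp_fun h1// h2//.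
by rewrite mulN1r.
Qed.

Section Action.
Context {A : topologicalZmodType} (chi : nat -> A -> R).
Hypothesis chi_rec : recurrent_system chi.

Let chi_hom j : torus_hom (chi j). Proof. by case: chi_rec. Qed.

Definition act_fun (g : A) u (x : R) : R :=
  Lp_fun u (rotation (chi ^~ g) x) + displacement p (chi ^~ g) x.

Lemma p_energy_displacement_fin g : (p_energy p (displacement p (chi ^~ g)) < +oo)%E.
Proof.
apply: (le_lt_trans (p_energy_displacement_le p p1 _ chi g)).
have [_ /(_ g) e _ _ _] := chi_rec.
by rewrite lte_mul_pinfty// ?lee_fin// nneseries_ge0// => j _ _; rewrite lee_fin mulr_ge0 ?dist_int_ge0// exprn_ge0.
Qed.

Lemma measurable_Lp_rotation g u :
  measurable_fun [set: R] (fun x => Lp_fun u (rotation (chi ^~ g) x)).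
Proof. exact: (measurableT_comp (measurable_Lp_fun u) (measurable_rotation _)). Qed.

Lemma act_fun_mem g u : act_fun g u \in Lfun mu p%:E.
Proof.
have h1 : (fun x => Lp_fun u (rotation (chi ^~ g) x)) \in Lfun mu p%:E.
  apply: mem_Lfun_p_energy; first exact: measurable_Lp_rotation.
  by rewrite p_energy_rotation; [exact: p_energy_Lp_fun|exact: measurable_Lp_fun].
have h2 : displacement p (chi ^~ g) \in Lfun mu p%:E.
  by apply: mem_Lfun_p_energy; [exact: measurable_displacement|exact: p_energy_displacement_fin].
exact: (rpredD h1 h2).
Qed.

Definition act g u : Lp := Lspace_class (Lfun_Sub pE1 (act_fun_mem g u)).

Lemma actE g u : Lp_fun (act g u) = act_fun g u %[ae mu].
Proof. exact: (Lspace_classK (Lfun_Sub pE1 (act_fun_mem g u))). Qed.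

Lemma act_subE g u v : Lp_fun (act g u - act g v) =
  (fun x => Lp_fun (u - v) (rotation (chi ^~ g) x)) %[ae mu].
Proof.
have h1 := Lp_funB (act g u) (act g v); have h2 := actE g u; have h3 := actE g v.
have h4 := ae_rotation (chi ^~ g) _ (Lp_funB u v).
near=> x => _; rewrite (near h1 x)// (near h2 x)// (near h3 x)// (near h4 x)//.
by rewrite /act_fun; ring.
Unshelve. all: by end_near. Qed.

Lemma act_isometry g u v : `|act g u - act g v| = `|u - v|.
Proof.
have := p_energy_normE _ _ (measurable_Lp_rotation g (u - v)) (act_subE g u v).
rewrite p_energy_rotation; last exact: measurable_Lp_fun.
rewrite p_energy_Lp_norm.
case=> e; apply: (powR_injective p0); rewrite ?nnegrE ?normr_ge0//.
Qed.

Lemma act_affine g (t : R) u v :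
  act g ((1 - t) *: u + t *: v) = (1 - t) *: act g u + t *: act g v.
Proof.
apply/Lspace_eqP.
have lin w z : Lp_fun ((1 - t) *: w + t *: z) =
    (fun x => (1 - t) * Lp_fun w x + t * Lp_fun z x) %[ae mu].
  have h1 := Lspace_addP ((1 - t) *: w) (t *: z).
  have h2 := Lspace_scaleP (1 - t) w; have h3 := Lspace_scaleP t z.
  by near=> x => _; rewrite /Lp_fun (near h1 x)// (near h2 x)// (near h3 x).
have h1 := actE g ((1 - t) *: u + t *: v).
have h2 := ae_rotation (chi ^~ g) _ (lin u v).
have h3 := lin (act g u) (act g v); have h4 := actE g u; have h5 := actE g v.
near=> x => _; rewrite -[LHS]/(Lp_fun _ x) -[RHS]/(Lp_fun _ x).
rewrite (near h1 x)// (near h3 x)// (near h4 x)// (near h5 x)// /act_fun (near h2 x)//.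
by ring.
Unshelve. all: by end_near. Qed.

Lemma act0 u : act 0 u = u.
Proof.
apply/Lspace_eqP; apply: filterS (actE 0 u) => x h _.
have id0 y : rotation (chi ^~ 0) y = y.
  by apply: rotation_id => j; exact: torus_hom0.
by rewrite -[LHS]/(Lp_fun _ x) h// /act_fun /displacement !id0 subrr addr0.
Qed.

Lemma actD g h u : act (g + h) u = act g (act h u).
Proof.
apply/Lspace_eqP; have h1 := actE (g + h) u; have h2 := actE g (act h u).
have h3 := ae_rotation (chi ^~ g) _ (actE h u).
near=> x => _; rewrite -[LHS]/(Lp_fun _ x) -[RHS]/(Lp_fun _ x).
rewrite (near h1 x)// (near h2 x)// /act_fun (near h3 x)// /act_fun /displacement.
rewrite -(@rotation_comp _ (chi ^~ h) (chi ^~ g) (chi ^~ (g + h))); first by ring.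
by move=> j; rewrite addrAC; exact: chi_hom.
Unshelve. all: by end_near. Qed.

Lemma act_affine_isometric : affine_isometric_action act.
Proof.
split; [exact: act0|exact: actD|exact: act_affine|exact: act_isometry].
Qed.

(** The displacement of [u] is the sum of the displacement under the linear part,
    small by strong continuity, and of that of the origin, small because the
    energy is. *)
Lemma act_sub_self_le u (e : R) : 0 < e -> \forall h \near (0 : A), `|act h u - u| <= e.
Proof.
move=> e0.
have c0 : 0 < 2 `^ p :> R by rewrite powR_gt0.
(* The loss of 2 ^ p is that of |a + b| ^ p <= 2 ^ p (|a| ^ p + |b| ^ p). *)
pose d := e `^ p / (2 `^ p * 2).
have d0 : 0 < d by rewrite divr_gt0 ?powR_gt0// mulr_gt0.
have [_ _ energy0 _ _] := chi_rec.
have theta0 j (r : R) : 0 < r -> \forall h \near (0 : A), dist_int (chi j h) <= r.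
  move=> r0; apply: filterS (energy0 _ r0) => h he.
  rewrite -lee_fin (le_trans _ he)//.
  have ge0 k : (0 <= (2 ^+ k * dist_int (chi k h))%:E)%E by rewrite lee_fin mulr_ge0 ?dist_int_ge0// exprn_ge0.
  apply: le_trans (nneseries_lim_ge j.+1 (fun k _ _ => ge0 k)).
  rewrite big_nat_recr//= (le_trans _ (leeDr _ _)) ?sume_ge0//.
  by rewrite lee_fin ler_peMl ?dist_int_ge0// exprn_ege1// ler1n.
have d4 : 0 < d / 4 by rewrite divr_gt0.
have nbhs0F : Filter (nbhs (0 : A)) := nbhs_filter (0 : A).
have rot0 := @Lp_rotation_continuous R A (nbhs (0 : A)) nbhs0F (fun h j => chi j h) p _ p1 theta0
  (measurable_Lp_fun u) (p_energy_Lp_fun u) _ d0.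
apply: filterS2 rot0 (energy0 _ d4) => h hu hd.
have hE : Lp_fun (act h u - u) = (fun x => (Lp_fun u (rotation (chi ^~ h) x) - Lp_fun u x) +
    displacement p (chi ^~ h) x) %[ae mu].
  apply: filterS2 (Lp_funB (act h u) u) (actE h u) => x h1 h2 _.
  by rewrite h1// h2// /act_fun; ring.
have mdiff : measurable_fun [set: R] (fun x => Lp_fun u (rotation (chi ^~ h) x) - Lp_fun u x).
  by apply: measurable_funB; [exact: measurable_Lp_rotation|exact: measurable_Lp_fun].
have mdisp := measurable_displacement p (chi ^~ h).
have := p_energy_normE _ _ (measurable_funD mdiff mdisp) hE.
have pe0 : 0 <= e `^ p by rewrite powR_ge0.
have bound : (p_energy p ((fun x => (Lp_fun u (rotation (chi ^~ h) x) - Lp_fun u x)%R) \+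
    displacement p (chi ^~ h))%R <= (e `^ p)%:E)%E.
  apply: (@le_trans _ _ (\int[mu]_x ((2 `^ p)%:E *
    ((`|Lp_fun u (rotation (chi ^~ h) x) - Lp_fun u x| `^ p)%:E +
     (`|displacement p (chi ^~ h) x| `^ p)%:E)))%E).
    apply: ge0_le_integral => //.
    - by apply: measurable_powR_norm; exact: measurable_funD.
    - by apply: measurable_funeM; apply: emeasurable_funD; exact: measurable_powR_norm.
    - move=> x _; rewrite -EFinD -EFinM lee_fin.
      apply: le_trans (powR_addr_le p p1 _ _ (normr_ge0 _) (normr_ge0 _)).
      by apply: powR_homo => //; exact: ler_normD.
  have mpdiff := measurable_powR_norm p _ mdiff; have mpdisp := measurable_powR_norm p _ mdisp.
  have ge0 f x : (0 <= (`|f x| `^ p)%:E)%E by rewrite lee_fin powR_ge0.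
  rewrite ge0_integralZl_EFin ?powR_ge0//; last 2 first.
  - by move=> x _; rewrite adde_ge0.
  - exact: emeasurable_funD.
  rewrite ge0_integralD//.
  apply: (@le_trans _ _ ((2 `^ p)%:E * (d%:E + d%:E))%E).
    apply: lee_wpmul2l; first by rewrite lee_fin ltW.
    apply: leeD; first exact: hu.
    apply: (le_trans (p_energy_displacement_le p p1 _ chi _)).
    apply: (@le_trans _ _ (4%:E * (d / 4)%:E)%E).
      by rewrite lee_pmul2l ?lte_fin.
    by rewrite -EFinM lee_fin mulrC divfK.
  rewrite -EFinD -EFinM lee_fin /d le_eqVlt; apply/orP; left; apply/eqP.
  by field; rewrite gt_eqF.
move=> normE; rewrite leNgt; apply/negP => /(gt0_ltr_powR p0) lt.
move: bound; rewrite normE lee_fin leNgt; apply/negP; rewrite negbK.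
by apply: lt; rewrite nnegrE// ltW.
Qed.

(** By isometry and the group law, continuity anywhere follows from continuity of
    orbit maps at the neutral element. *)
Lemma act_continuous : continuous_action act.
Proof.
move=> [g0 u0]; apply/cvgrPdist_le => e e0.
have e2 : 0 < e / 2 by rewrite divr_gt0.
exists ([set g | `|act (g - g0) u0 - u0| <= e / 2], [set u | `|u0 - u| <= e / 2]) => /=.
  split; first exact: (nbhs_translate g0 _ (act_sub_self_le u0 _ e2)).
  apply/nbhs_ballP; exists (e / 2) => // v; rewrite -ball_normE /=; exact: ltW.
move=> [g u] [/= hg hu].
apply: (le_trans (ler_distD (act g u0) _ _)); rewrite [e]splitr; apply: lerD.
  by rewrite distrC -[g](subrKC g0) actD act_isometry.
by rewrite act_isometry.
Qed.

Lemma p_energy_act0 g : p_energy p (displacement p (chi ^~ g)) = (`|act g 0| `^ p)%:E.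
Proof.
apply: p_energy_normE; first exact: measurable_displacement.
have z0 : Lp_fun 0 = (fun=> 0) %[ae mu].
  apply: filterS (Lspace_scaleP 0 (0 : Lp)) => x; rewrite scale0r => h _.
  by rewrite /Lp_fun h// mul0r.
apply: filterS2 (actE g 0) (ae_rotation (chi ^~ g) _ z0) => x h1 h2 _.
by rewrite h1// /act_fun h2// add0r.
Qed.

(** Some element moves a quarter of the j-th circle across, which costs at least
    2 ^ j / 4, and j is arbitrary. *)
Lemma act_not_bounded : ~ bounded_action act.
Proof.
move=> /(_ 0) [M [_ /(_ (`|M| + 1))]].
rewrite (le_lt_trans (ler_norm M)) ?ltrDl// => /(_ isT) bd.
have [_ _ _ chi_big _] := chi_rec.
pose r := (`|M| + 1) `^ p.
have r0 : 0 <= r by rewrite powR_ge0.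
pose j := Num.bound (4 * r).
have [g g4] := chi_big j.
have := p_energy_displacement_ge p p1 (chi ^~ g) j g4.
rewrite p_energy_act0 lee_fin leNgt => /negP; apply.
apply: (@le_lt_trans _ _ r).
  by apply: powR_homo => //; apply: bd; exists g.
rewrite ltr_pdivlMr// mulrC; apply: (@lt_trans _ _ j%:R).
  by apply: archi_boundP; rewrite mulr_ge0.
by rewrite -natrX ltr_nat ltn_expl.
Qed.

Lemma act_not_proper : ~ proper_action act.
Proof.
move=> prop; have [_ _ _ _ [C nC]] := chi_rec.
apply: nC; apply: precompact_subset (prop 0 ((4 * Num.max C 0) `^ p^-1)) => g /= gC.
have M0 : 0 <= 4 * Num.max C 0 by rewrite mulr_ge0// le_max lexx orbT.
rewrite subr0 leNgt; apply/negP => /(gt0_ltr_powR p0); rewrite !nnegrE => lt.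
have {}lt := lt (powR_ge0 _ _) (normr_ge0 _).
move: lt; rewrite -powRrM mulVf ?gt_eqF// powRr1//.
rewrite ltNge => /negP; apply; rewrite -lee_fin -p_energy_act0.
apply: (le_trans (p_energy_displacement_le p p1 _ chi _)).
rewrite EFinM lee_pmul2l ?lte_fin// (le_trans gC)// lee_fin le_max lexx.
by [].
Qed.

End Action.
End Lp.

(** * The equivalences *)

Section Equivalences.
Context {R : realType} {A : topologicalZmodType}.

(** The distance between the origin and its image is a length function, and by
    isometry it determines up to a constant the displacement of any point. *)
Lemma PL_BPLp (p : R) (p1 : (1 <= p%:E)%E) : property_PL R A -> property_BPLp p1 A.
Proof.
move=> PL d X mu act [act0 actD _ actI] act_cont.
pose L g := `|act g 0 - 0|.
have actN g : `|act (- g) 0 - 0| = L g.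
  by rewrite /L -[in LHS](actI g) -actD subrr act0 distrC.
have act_cont0 : continuous (fun g => act g 0).
  move=> g; pose z : LspaceType mu p1 := 0.
  have gz : (fun g' : A => (g', z)) @ g --> (nbhs g, nbhs z).
    by apply: cvg_pair; [exact: cvg_id|exact: cvg_cst].
  exact: (cvg_comp _ _ gz (act_cont (g, z))).
have lenL : length_function L.
  split=> [g|K cK|g|g h]; [exact: normr_ge0| |exact: actN|].
    have : compact ((fun g => act g 0) @` K).
      by apply: (@continuous_compact A _ (fun g => act g 0)) cK; exact: continuous_subspaceT.
    move=> /compact_bounded[M [_ /(_ (`|M| + 1))]].
    rewrite (le_lt_trans (ler_norm M)) ?ltrDl// => /(_ isT) bd.
    by exists (`|M| + 1) => _ [g Kg <-]; rewrite /L subr0; apply: bd; exists g.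
  have := ler_distD (act g 0) (act g (act h 0)) 0.
  by rewrite (actI g (act h 0) 0) -actD [leRHS]addrC; exact.
have orbit g x : `|act g x - act g 0| = `|x| by rewrite actI subr0.
have [[M LM]|Lprop] := PL L lenL; [left|right].
  move=> x; exists (M + `|x|); split; first exact: num_real.
  move=> N MN _ [g _ <-]; apply: ltW; apply: le_lt_trans MN.
  rewrite -[act g x](subrK (act g 0)) (le_trans (ler_normD _ _))// orbit addrC lerD2r.
  by apply: LM; exists g => //; rewrite /L subr0.
(* Moving from the point x to the origin changes displacements by at most 2 |x|. *)
move=> x r; pose s := `|r| + (`|x| + `|x|).
apply: precompact_subset (Lprop s _); last by rewrite !addr_ge0.
move=> g /= gr; rewrite /L subr0.
rewrite -[act g 0](subrK (act g x)) (le_trans (ler_normD _ _))//.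
rewrite distrC orbit /s addrCA lerD2l.
rewrite -[act g x](subrK x) (le_trans (ler_normD _ _))// lerD2r.
exact: le_trans gr (ler_norm r).
Qed.

Lemma BPLp_compact (p : R) (p1 : (1 <= p%:E)%E) :
  locally_compact [set: A] -> property_BPLp p1 A -> compact [set: A].
Proof.
move=> lcA BP; apply: contrapT => ncA.
have [chi chi_rec] := @noncompact_recurrent_system R A lcA ncA.
have [|] := BP _ _ (@lebesgue_measure R) (act p p1 chi chi_rec)
  (act_affine_isometric _ _ _ _) (act_continuous _ _ _ _).
- exact: act_not_bounded.
- exact: act_not_proper.
Qed.

Lemma compact_PL : compact [set: A] -> property_PL R A.
Proof. by move=> cA L [_ Lb _ _]; left; exact: Lb. Qed.

Lemma compact_BPLp (p : R) (p1 : (1 <= p%:E)%E) :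
  compact [set: A] -> property_BPLp p1 A.
Proof. by move=> cA; apply: PL_BPLp; exact: compact_PL. Qed.

End Equivalences.

Theorem theorem1p3 (R : realType) (A : topologicalZmodType)
    (A_hausdorff : hausdorff_space A)
    (A_locally_compact : locally_compact [set: A]) :
  [<-> property_PL R A;
       exists (p : R) (p1 : (1 <= p%:E)%E), property_BPLp p1 A;
       forall (p : R) (p1 : (1 <= p%:E)%E), property_BPLp p1 A;
       compact [set: A]].
Proof.
tfae.
- by move=> PL; exists 1, (lexx _); exact: PL_BPLp.
- by move=> [p [p1 BP]] q q1; apply: compact_BPLp; exact: BPLp_compact BP.
- by move=> BP; exact: BPLp_compact (BP 1 (lexx _)).
- exact: compact_PL.
Qed.
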